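(* Let $L,H,F,G,m_0^*$ satisfy all the assumptions on the data listed in the context, let $\mu\in C([0,T];\mathcal P_1(\mathbb R^d))$, and let $\Delta=(\Delta t,\Delta x,\varepsilon)\in\,]0,\infty[^3$ (with $T/\Delta t\in\mathbb N^*$). Then, for every $c>0$, if $\Delta x\le c\Delta t$, we have $$d_1\big(\mathsf m^\Delta[\mu](t),\mathsf m^\Delta[\mu](s)\big)\le(C_{\rm bf}+c\sqrt d)\,|t-s|\quad\text{for all }t,s\in[0,T],$$ where $\mathsf m^\Delta[\mu](t)\in\mathcal P_1(\mathbb R^d)$ denotes the measure with density $\mathsf m^\Delta[\mu](t,\cdot)$, and $C_{\rm bf}>0$ is the constant, independent of $(\mu,\Delta)$, fixed in the context.
   Context: **General notation.** $d\in\mathbb N$, $d\ge1$, $T>0$; $|\cdot|$ is the Euclidean norm, $|\cdot|_\infty$ the maximum norm on $\mathbb R^d$; $\overline B(0,r)$, $\overline B_\infty(0,r)$ are the corresponding closed balls. $\mathcal P_1(\mathbb R^d)$ is the set of Borel probability measures with finite first moment, with the 1-Wasserstein distance $d_1$ (for the Euclidean norm); $C([0,T];\mathcal P_1(\mathbb R^d))$ carries the uniform distance. **Assumptions on the data.** (1) $L:\mathbb R^d\times\mathbb R^d\to\mathbb R$ is $C^2$, bounded from below, and for some constants $C_{L,i}>0$ and all $x,a,b,y\in\mathbb R^d$: $L(x,a)\le C_{L,1}|a|^2+C_{L,2}$; $|D_xL(x,a)|\le C_{L,3}(1+|a|^2)$; $C_{L,4}|b|^2\le\langle D^2_{aa}L(x,a)b,b\rangle$;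 $\langle D^2_{xx}L(x,a)y,y\rangle\le C_{L,5}(1+|a|^2)|y|^2$. $H(x,p)=\sup_{a\in\mathbb R^d}(\langle a,p\rangle-L(x,a))$ (which is then finite and of class $C^2$). (2) $F,G:\mathbb R^d\times\mathcal P_1(\mathbb R^d)\to\mathbb R$ are continuous and, for $h\in\{F,G\}$, there are constants $C_{h,i}>0$ such that for all $x,y\in\mathbb R^d$, $\nu\in\mathcal P_1(\mathbb R^d)$: $|h(x,\nu)|\le C_{h,1}$; $|h(x,\nu)-h(y,\nu)|\le C_{h,2}|x-y|$; $h(x+y,\nu)-2h(x,\nu)+h(x-y,\nu)\le C_{h,3}|y|^2$. (3) $m_0^*\in\mathcal P_1(\mathbb R^d)$ is absolutely continuous, with density (still denoted $m_0^*$) in $L^{\mathsf p}(\mathbb R^d)$ for a fixed $\mathsf p\in\,]1,\infty]$, and $\mathrm{supp}(m_0^* )\subset\overline B_\infty(0,C^* )$ for some $C^*>0$. **Semi-Lagrangian scheme.** Let $\mu\in C([0,T];\mathcal P_1(\mathbb R^d))$. With $X^{t,x,\alpha}(s)=x-\int_t^s\alpha(r)\,dr$ and $J^{t,x}[\mu](\alpha)=\int_t^T\big(L(X^{t,x,\alpha}(s),\alpha(s))+F(X^{t,x,\alpha}(s),\mu(s))\big)ds+G(X^{t,x,\alpha}(T),\mu(T))$, $C_{\rm b}>0$ is a fixed constant such that for every $\mu,t,x$ the infimum of $J^{t,x}[\mu]$ over $L^2([t,T];\mathbb R^d)$ is attained by some $\alpha$ with $\|\alpha\|_{L^\infty}\le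 C_{\rm b}$ (such a constant exists). $\Delta t=T/N$, $N\in\mathbb N^*$, $t_k=k\Delta t$, $\mathcal I_{\Delta t}=\{0,\dots,N\}$, $\mathcal I^*_{\Delta t}=\{0,\dots,N-1\}$; $\Delta x>0$, $x_i=i\Delta x$ for $i\in\mathbb Z^d$. $\beta^1_i(z)=\prod_{l=1}^d\max\{0,1-|z_l/\Delta x-i_l|\}$, and $I^1[\phi](x)=\sum_{i\in\mathbb Z^d}\phi_i\beta_i^1(x)$ for $\phi=(\phi_i)_{i\in\mathbb Z^d}$. Define $v_{N,i}=G(x_i,\mu(T))$ and, for $k\in\mathcal I^*_{\Delta t}$, $v_{k,i}=\inf_{a\in\overline B(0,C_{\rm b})}\big[\Delta tL(x_i,a)+I^1[v_{k+1}](x_i-\Delta t\,a)\big]+\Delta tF(x_i,\mu(t_k))$. Set $v^{\Delta t,\Delta x}[\mu](t,x)=I^1[v_k](x)$ for $t\in[t_k,t_{k+1}[$, $k\in\mathcal I_{\Delta t}^*$, and $v^{\Delta t,\Delta x}[\mu](T,x)=I^1[v_N](x)$. **Mollification.** $\rho\in C^\infty(\mathbb R^d)$ is a fixed function, $\rho\ge0$, $\int\rho=1$, with bounded derivatives of any order, $\int|x|\rho(x)dx<\infty$ and all derivatives of $\rho$ in $L^1(\mathbb R^d)$; $\rho_\varepsilon(x)=\varepsilon^{-d}\rho(x/\varepsilon)$. For $\Delta=(\Delta t,\Delta x,\varepsilon)$, $v^\Delta[\mu](t,\cdot)=\rho_\varepsilon*v^{\Delta t,\Delta x}[\mu](t,\cdot)$.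 $C_{\rm bf}>0$ is a fixed constant, independent of $(\mu,\Delta)$, such that $|D_pH(x,D_xv^\Delta[\mu](t,x))|\le C_{\rm bf}$ for all $(t,x)\in[0,T]\times\mathbb R^d$ (such a constant exists). **Lagrange–Galerkin scheme.** $\mathsf\Phi^\Delta_k[\mu](x)=x-\Delta t\,D_pH(x,D_xv^\Delta[\mu](t_k,x))$; $E_i=\{x\in\mathbb R^d: -\Delta x/2\le (x-x_i)_l<\Delta x/2,\ l=1,\dots,d\}$, $\beta_i^0=\mathbb I_{E_i}$ (indicator function). $m_{0,i}=(\Delta x)^{-d}\int_{E_i}m_0^*(x)dx$, $m_{k+1,i}=(\Delta x)^{-d}\sum_{j\in\mathbb Z^d}m_{k,j}\int_{E_j}\beta_i^0(\mathsf\Phi_k^\Delta[\mu](x))dx$ for $k\in\mathcal I_{\Delta t}^*$. $\mathsf m^\Delta[\mu](t_k,x)=\sum_jm_{k,j}\beta_j^0(x)$, extended to $t\in[0,T]$ by affine interpolation in time on each $[t_k,t_{k+1}]$. *)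

(* Defs.v *)
From HB Require Import structures.
From mathcomp Require Import all_boot all_order all_algebra.
From mathcomp Require Import all_classical all_reals all_analysis.
Set Implicit Arguments.
Unset Strict Implicit.
Unset Printing Implicit Defensive.
Import Order.TTheory GRing.Theory Num.Theory.
Import numFieldNormedType.Exports.
Local Open Scope classical_set_scope.
Local Open Scope ring_scope.

Definition borel_rV_display : measure_display.
Proof. exact: default_measure_display. Qed.

(* Borel sigma-algebra on row vectors. The library topology on 'rV[R]_n is that
   of the maximum norm, i.e. the usual one. *)
Section borel_rV.
Context (R : realType) (n : nat).

HB.instance Definition _ := @isMeasurable.Build
  borel_rV_display 'rV[R]_n <<s (@open 'rV[R]_n) >>
  (@sigma_algebra0 _ setT (@open 'rV[R]_n)) (@sigma_algebraC _ (@open 'rV[R]_n))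
  (@sigma_algebra_bigcup _ setT (@open 'rV[R]_n)).

Lemma measurable_rVE : measurable = <<s (@open 'rV[R]_n) >>.
Proof. by []. Qed.

Lemma open_measurable_rV (A : set 'rV[R]_n) : open A -> measurable A.
Proof. exact: sub_sigma_algebra. Qed.

Lemma measurable_coord (i : 'I_n) :
  @measurable_fun _ _ 'rV[R]_n (measurableTypeR R) setT (fun x => x 0 i).
Proof.
apply: (@measurability _ _ _ (measurableTypeR R) _ _ (@measurable_realfun.RGenOpens.G R)).
  exact: measurable_realfun.RGenOpens.measurableE.
move=> _ [_ [a [b ->]] <-]; rewrite setTI.
apply: open_measurable_rV; apply: open_comp; last exact: interval_open.
by move=> x _; exact: coord_continuous.
Qed.

Lemma open_rV_bigcup (U : set 'rV[R]_n) : open U ->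
  U = \bigcup_(q in [set q : 'rV[rat]_n * nat |
     ball (map_mx ratr q.1 : 'rV[R]_n) (q.2.+1%:R^-1) `<=` U])
     ball (map_mx ratr q.1 : 'rV[R]_n) (q.2.+1%:R^-1).
Proof.
move=> oU; apply/seteqP; split=> [x Ux|x [q /= qU qx]]; last exact: qU.
have := open_nbhs_nbhs (conj oU Ux) => /nbhs_ballP[e /= e0 eU].
have [k ke] : exists k : nat, k.+1%:R^-1 < e / 2 :> R.
  exists (Num.truncn (e / 2)^-1); rewrite invf_plt ?posrE ?divr_gt0//.
  exact: truncnS_gt.
have /choice [q qx] : forall i : 'I_n, exists q : rat, `|x 0 i - ratr q| < k.+1%:R^-1.
  move=> i.
  have : x 0 i - k.+1%:R^-1 < x 0 i + k.+1%:R^-1.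
    by rewrite ltrD2l gtrN// invr_gt0.
  move=> /rat_in_itvoo[q]; rewrite in_itv/= => qi; exists q.
  by rewrite ltr_distlC.
exists (\row_i q i, k) => /=.
  move=> y; rewrite -ball_normE/= => hy; apply: eU.
  have xb : ball (map_mx ratr (\row_i q i) : 'rV[R]_n) k.+1%:R^-1 x.
    by split=> // i j; rewrite !mxE ord1 /ball/= distrC.
  rewrite -ball_normE/=.
  move: xb; rewrite -ball_normE/= => xb.
  rewrite (le_lt_trans (ler_distD (map_mx ratr (\row_i q i)) _ _))//.
  by rewrite [ltRHS](splitr e) ltrD// ?(lt_trans _ ke)// distrC.
by split=> // i j; rewrite !mxE ord1 /ball/= distrC.
Qed.


Lemma measurable_fun_rV d (X : measurableType d) (D : set X) (f : X -> 'rV[R]_n) :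
  (forall i, @measurable_fun _ _ X (measurableTypeR R) D (fun x => f x 0 i)) ->
  measurable_fun D f.
Proof.
move=> mf mD; apply: (@measurability _ _ _ _ _ _ (@open 'rV[R]_n)) => //.
move=> _ [U oU <-]; rewrite (open_rV_bigcup oU) preimage_bigcup setI_bigcupr bigcup_mkcond.
apply: countable_bigcupT_measurable => // -[q k]; case: ifP => // _.
rewrite (_ : _ `&` _ = D `&` \bigcap_(i in [set: 'I_n])
    (D `&` (fun x => f x 0 i) @^-1` ball (ratr (q 0 i) : R) k.+1%:R^-1)).
  apply: measurableI => //; apply: fin_bigcap_measurable => [|i _]; first exact: finite_finset.
  by apply: mf => //; rewrite ball_itv; exact: measurable_itv.
apply/seteqP; split => x /=.
  by move=> [Dx [_ qx]]; split=> // i _; split=> //=; have := qx 0 i; rewrite mxE.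
move=> [Dx qx]; split=> //; split => [|i j]; first by rewrite invr_gt0.
by have [_ /=] := qx j I; rewrite mxE ord1.
Qed.

End borel_rV.

Definition consrV (R : realType) (n : nat)
    (z : measurableTypeR R * 'rV[R]_n) : 'rV[R]_n.+1 :=
  row_mx (const_mx z.1 : 'rV[R]_1) z.2.

Section consrV.
Context (R : realType) (n : nat).

Let uncons (x : 'rV[R]_n.+1) : measurableTypeR R * 'rV[R]_n :=
  (x 0 0, \row_j x 0 (lift 0 j)).

Lemma consrV0 z : @consrV R n z 0 0 = z.1.
Proof.
by rewrite mxE; case: splitP => // k _; rewrite mxE.
Qed.

Lemma consrVS z j : @consrV R n z 0 (lift 0 j) = z.2 0 j.
Proof.
rewrite mxE; case: splitP => k /=; first by rewrite ord1.
by rewrite /bump/= => /addnI jk; congr (z.2 _ _); exact/val_inj.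
Qed.

Lemma measurable_consrV : measurable_fun setT (@consrV R n).
Proof.
apply: measurable_fun_rV => i; case: (unliftP 0 i) => [j ->|->].
  under [X in measurable_fun _ X]eq_fun do rewrite consrVS.
  by apply: (measurableT_comp (measurable_coord j)); exact: measurable_snd.
under [X in measurable_fun _ X]eq_fun do rewrite consrV0.
exact: measurable_fst.
Qed.

Let measurable_uncons : measurable_fun setT uncons.
Proof.
apply/measurable_fun_pairP; split; first exact: measurable_coord.
apply: measurable_fun_rV => i.
under [X in measurable_fun _ X]eq_fun do rewrite /= mxE.
exact: measurable_coord.
Qed.

Definition lebesgue_cons (m : {sigma_finite_measure set 'rV[R]_n -> \bar R}) :
    set 'rV[R]_n.+1 -> \bar R :=
  pushforward (lebesgue_measure \x m)%E (@consrV R n).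

Section lebesgue_cons.
Context (m : {sigma_finite_measure set 'rV[R]_n -> \bar R}).

Let mu : {measure set 'rV[R]_n.+1 -> \bar R} :=
  measure_function_pushforward__canonical__measure_function_Measure
    (lebesgue_measure \x m)%E measurable_consrV.

HB.instance Definition _ := isMeasure.Build _ _ _ (lebesgue_cons m)
  (measure0 mu) (measure_ge0 mu) (@measure_semi_sigma_additive _ _ _ mu).

Let sigma_finite_lebesgue_cons : sigma_finite setT (lebesgue_cons m).
Proof.
have /sigma_finiteP[F [TF ndF Foo]] := sigma_finiteT (@lebesgue_measure R).
have /sigma_finiteP[G [TG ndG Goo]] := sigma_finiteT m.
exists (fun k => uncons @^-1` (F k `*` G k)).
  apply/seteqP; split=> // x _.
  have : [set: measurableTypeR R] (uncons x).1 by [].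
  have : [set: 'rV[R]_n] (uncons x).2 by [].
  rewrite {1}TF {1}TG => -[k _ Gk] [l _ Fl]; exists (maxn k l) => //; split.
  - by apply: (subsetPset _ _ (ndF _ _ (leq_maxr _ _))).
  - by apply: (subsetPset _ _ (ndG _ _ (leq_maxl _ _))).
move=> k; have [mF Fk] := Foo k; have [mG Gk] := Goo k; split.
  rewrite -[X in measurable X]setTI.
  by apply: measurable_uncons => //; exact: measurableX.
rewrite /lebesgue_cons /pushforward (_ : _ @^-1` _ = F k `*` G k).
  by rewrite product_measure1E// lte_mul_pinfty// ge0_fin_numE.
have K z : uncons (consrV z) = z.
  case: z => a b; rewrite /uncons consrV0; congr pair.
  by apply/rowP => j; rewrite mxE consrVS.
by apply/seteqP; split=> z; rewrite /preimage /mkset K.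
Qed.

HB.instance Definition _ := Measure_isSigmaFinite.Build _ _ _ (lebesgue_cons m)
  sigma_finite_lebesgue_cons.

End lebesgue_cons.

End consrV.

(* n-dimensional Lebesgue measure, as an iterated product of the 1-dimensional
   one transported along the bijection R * R^n -> R^(n + 1). *)
Fixpoint lebesgue_rV (R : realType) (n : nat) :
    {sigma_finite_measure set 'rV[R]_n -> \bar R} :=
  match n with
  | 0 => dirac (0 : 'rV[R]_0)
  | n'.+1 => lebesgue_cons (lebesgue_rV R n')
  end.

Lemma lebesgue_rV_box (R : realType) (n : nat) (A : 'I_n -> set (measurableTypeR R)) :
  (forall i, measurable (A i)) ->
  lebesgue_rV R n [set x : 'rV[R]_n | forall i, A i (x 0 i)] =
  (\prod_(i < n) lebesgue_measure (A i))%E.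
Proof.
elim: n A => [|n IHn] A mA.
  rewrite big_ord0 /= diracE (_ : _ \in _)//; by apply/mem_set => -[].
rewrite big_ord_recl -IHn//.
rewrite -(@product_measure1E _ _ _ _ _ lebesgue_measure (lebesgue_rV R n))//; last first.
  rewrite (_ : mkset _ = \bigcap_(i in [set: 'I_n])
      ((fun x : 'rV[R]_n => x 0 i : measurableTypeR R) @^-1` A (lift 0 i))).
    apply: fin_bigcap_measurable => [|i _]; first exact: finite_finset.
    by rewrite -[X in measurable X]setTI; exact: measurable_coord.
  by apply/seteqP; split=> x Ax i; [move=> _; exact: Ax|exact: (Ax i Logic.I)].
rewrite /= /lebesgue_cons /pushforward; congr (_ _).
apply/seteqP; split=> [z /= Az|z /= [A0 AS] i].
  split=> [|j]; first by have := Az 0; rewrite consrV0.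
  by have := Az (lift 0 j); rewrite consrVS.
by case: (unliftP 0 i) => [j ->|->]; rewrite ?consrV0 ?consrVS.
Qed.

Section euclidean.
Context (R : realType) (d : nat).
Implicit Types x y p : 'rV[R]_d.

Definition dotrv x y : R := \sum_i x 0 i * y 0 i.

(* [`|x|] is the maximum norm on 'rV[R]_d; this is the Euclidean one. *)
Definition enorm x : R := Num.sqrt (dotrv x x).

Definition partial (i : 'I_d) (f : 'rV[R]_d -> R) : 'rV[R]_d -> R :=
  fun x => 'D_(delta_mx 0 i) f x.

Definition grad (f : 'rV[R]_d -> R) x : 'rV[R]_d := \row_i partial i f x.

Definition hess (f : 'rV[R]_d -> R) x : 'M[R]_d :=
  \matrix_(i, j) partial i (partial j f) x.

Definition partials (s : seq 'I_d) (f : 'rV[R]_d -> R) : 'rV[R]_d -> R :=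
  foldr partial f s.

End euclidean.

Fixpoint Ck (R : realType) (V : normedModType R) (k : nat) (f : V -> R) : Prop :=
  match k with
  | 0 => continuous f
  | k'.+1 => (forall x, differentiable f x) /\
             (forall v, Ck k' (fun x => 'D_v f x))
  end.

Record P1 (R : realType) (d : nat) := MkP1 {
  P1_prob :> probability 'rV[R]_d R;
  P1_moment : (\int[P1_prob]_x (enorm x)%:E < +oo)%E }.

(* The product sigma-algebra on R^d * R^d coincides with its Borel one. *)
Definition coupling (R : realType) (d : nat) (nu1 nu2 : P1 R d)
    (pi : probability ('rV[R]_d * 'rV[R]_d)%type R) : Prop :=
  forall A : set 'rV[R]_d, measurable A ->
    pi (A `*` setT) = nu1 A /\ pi (setT `*` A) = nu2 A.

Definition d1 (R : realType) (d : nat) (nu1 nu2 : P1 R d) : \bar R :=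
  ereal_inf [set (\int[pi]_z (enorm (z.1 - z.2))%:E)%E | pi in coupling nu1 nu2].

(* Membership in C([0, T]; P1); values of [mu] outside [0, T] are irrelevant. *)
Definition continuous_curve (R : realType) (d : nat) (T : R) (mu : R -> P1 R d) : Prop :=
  forall t, 0 <= t <= T -> forall e, 0 < e -> exists2 delta, 0 < delta &
    forall s, 0 <= s <= T -> `|s - t| < delta -> (d1 (mu s) (mu t) < e%:E)%E.

Section data.
Context (R : realType) (d : nat).
Implicit Types (L : 'rV[R]_d -> 'rV[R]_d -> R) (h : 'rV[R]_d -> P1 R d -> R).

Definition lagrangian L : Prop :=
  [/\ Ck 2 (fun z : 'rV[R]_d * 'rV[R]_d => L z.1 z.2),
      exists m, forall x a, m <= L x a
    & exists C1 C2 C3 C4 C5 : R,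
        [/\ 0 < C1, 0 < C2, 0 < C3, 0 < C4 & 0 < C5] /\
        forall x a b y,
          [/\ L x a <= C1 * enorm a ^+ 2 + C2,
              enorm (grad (L^~ a) x) <= C3 * (1 + enorm a ^+ 2),
              C4 * enorm b ^+ 2 <= dotrv (b *m hess (L x) a) b
            & dotrv (y *m hess (L^~ a) x) y <=
                C5 * (1 + enorm a ^+ 2) * enorm y ^+ 2]].

Definition hamiltonian L (x p : 'rV[R]_d) : R :=
  sup [set dotrv a p - L x a | a in [set: 'rV[R]_d]].

Definition coupling_cost h : Prop :=
  (forall x nu e, 0 < e -> exists2 delta, 0 < delta &
     forall y nu', enorm (y - x) < delta -> (d1 nu' nu < delta%:E)%E ->
       `|h y nu' - h x nu| < e) /\
  exists C1 C2 C3 : R, [/\ 0 < C1, 0 < C2 & 0 < C3] /\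
    forall x y nu,
      [/\ `|h x nu| <= C1,
          `|h x nu - h y nu| <= C2 * enorm (x - y)
        & h (x + y) nu - 2 * h x nu + h (x - y) nu <= C3 * enorm y ^+ 2].

Definition msupport (nu : set 'rV[R]_d -> \bar R) : set 'rV[R]_d :=
  [set x | forall U, open U -> U x -> (0 < nu U)%E].

(* [`|x|] is the maximum norm; [m0] is the density of [m0s]. *)
Definition initial_datum (m0s : P1 R d) (m0 : 'rV[R]_d -> R) (p : \bar R) (C : R) : Prop :=
  [/\ measurable_fun setT m0,
      {ae lebesgue_rV R d, forall x, 0 <= m0 x},
      forall A, measurable A -> m0s A = (\int[lebesgue_rV R d]_(x in A) (m0 x)%:E)%E,
      ('N[lebesgue_rV R d]_p[EFin \o m0] < +oo)%E
    & msupport m0s `<=` [set x | `|x| <= C]].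

Definition mollifier (rho : 'rV[R]_d -> R) : Prop :=
  (forall k, Ck k rho) /\
  [/\ forall x, 0 <= rho x,
      (\int[lebesgue_rV R d]_x (rho x)%:E = 1)%E,
      forall s, exists C, forall x, `|partials s rho x| <= C,
      forall s, (lebesgue_rV R d).-integrable setT (EFin \o partials s rho)
    & (\int[lebesgue_rV R d]_x (enorm x * rho x)%:E < +oo)%E].

End data.

Section control.
Context (R : realType) (d : nat) (T : R).
Context (L : 'rV[R]_d -> 'rV[R]_d -> R) (F G : 'rV[R]_d -> P1 R d -> R).
Implicit Types (t s : R) (x : 'rV[R]_d) (alpha : R -> 'rV[R]_d) (mu : R -> P1 R d).

Definition L2_control t alpha : Prop :=
  measurable_fun `[t, T] alpha /\
  (\int[lebesgue_measure]_(s in `[t, T]) (enorm (alpha s) ^+ 2)%:E < +oo)%E.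

Definition trajectory t x alpha s : 'rV[R]_d :=
  x - \row_i \int[lebesgue_measure]_(r in `[t, s]) alpha r 0 i.

Definition control_cost mu t x alpha : R :=
  \int[lebesgue_measure]_(s in `[t, T])
     (L (trajectory t x alpha s) (alpha s) + F (trajectory t x alpha s) (mu s))
  + G (trajectory t x alpha T) (mu T).

Definition optimal_control_bound (Cb : R) : Prop :=
  forall mu, continuous_curve T mu -> forall t x, 0 <= t <= T ->
  exists alpha, [/\ L2_control t alpha,
    {ae lebesgue_measure, forall s, s \in `[t, T] -> enorm (alpha s) <= Cb}
  & forall alpha', L2_control t alpha' ->
      control_cost mu t x alpha <= control_cost mu t x alpha'].

End control.

Section grid.
Context (R : realType) (d : nat) (dx : R).
Implicit Types (i : 'rV[int]_d) (x : 'rV[R]_d).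

Definition node i : 'rV[R]_d := \row_l ((i 0 l)%:~R * dx).

Definition beta1 i x : R :=
  \prod_(l < d) Num.max 0 (1 - `|x 0 l / dx - (i 0 l)%:~R|).

(* Finitely supported sum: at most 2 ^ d of the [beta1 i x] are nonzero. *)
Definition interp1 (phi : 'rV[int]_d -> R) x : R :=
  \sum_(i \in [set: 'rV[int]_d]) phi i * beta1 i x.

Definition cell i : set 'rV[R]_d :=
  [set x | forall l, - (dx / 2) <= (x - node i) 0 l < dx / 2].

Definition beta0 i x : R := \1_(cell i) x.

End grid.

Section scheme.
Context (R : realType) (d : nat) (T : R).
Context (L : 'rV[R]_d -> 'rV[R]_d -> R) (F G : 'rV[R]_d -> P1 R d -> R).
Context (Cb : R) (rho m0 : 'rV[R]_d -> R).
Context (N : nat) (dx eps : R) (mu : R -> P1 R d).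

Definition dt : R := T / N%:R.

Definition tk (k : nat) : R := k%:R * dt.

(* [value_back n] is v_{N - n}: the recursion is backward in time. *)
Fixpoint value_back (n : nat) : 'rV[int]_d -> R :=
  match n with
  | 0 => fun i => G (node dx i) (mu T)
  | n'.+1 => fun i =>
      inf [set dt * L (node dx i) a
               + interp1 dx (value_back n') (node dx i - dt *: a)
          | a in [set a : 'rV[R]_d | enorm a <= Cb]]
      + dt * F (node dx i) (mu (tk (N - n'.+1)))
  end.

Definition value (k : nat) : 'rV[int]_d -> R := value_back (N - k).

(* For t in [0, T], [Num.truncn (t / dt)] is the k with t_k <= t < t_{k+1};
   it is N at t = T. *)
Definition value_fun (t : R) : 'rV[R]_d -> R :=
  interp1 dx (value (Num.truncn (t / dt))).

Definition rho_eps (x : 'rV[R]_d) : R := eps ^- d * rho (eps^-1 *: x).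

(* The convolution of [rho_eps] with [value_fun t]. *)
Definition value_mollified (t : R) (x : 'rV[R]_d) : R :=
  \int[lebesgue_rV R d]_y (rho_eps y * value_fun t (x - y)).

Definition drift (t : R) (x : 'rV[R]_d) : 'rV[R]_d :=
  grad (hamiltonian L x) (grad (value_mollified t) x).

Definition flow (k : nat) (x : 'rV[R]_d) : 'rV[R]_d := x - dt *: drift (tk k) x.

(* All summands are nonnegative, so the unordered sum [esum] is the series over
   Z^d; it is finite, hence [fine] loses nothing. *)
Fixpoint mass (k : nat) : 'rV[int]_d -> R :=
  match k with
  | 0 => fun i => dx ^- d * \int[lebesgue_rV R d]_(x in cell dx i) m0 x
  | k'.+1 => fun i => dx ^- d *
      fine (\esum_(j in [set: 'rV[int]_d])
        (mass k' j * \int[lebesgue_rV R d]_(x in cell dx j) beta0 dx i (flow k' x))%:E)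
  end.

Definition density_node (k : nat) (x : 'rV[R]_d) : R :=
  \sum_(j \in [set: 'rV[int]_d]) mass k j * beta0 dx j x.

(* Affine interpolation on [t_k, t_{k+1}] with k = [Num.truncn (t / dt)]; at
   t = T the weight of [density_node N.+1] is 0. *)
Definition density (t : R) (x : 'rV[R]_d) : R :=
  let k := Num.truncn (t / dt) in
  let theta := t / dt - k%:R in
  (1 - theta) * density_node k x + theta * density_node k.+1 x.

End scheme.

Definition drift_bound (R : realType) (d : nat) (T : R)
    (L : 'rV[R]_d -> 'rV[R]_d -> R) (F G : 'rV[R]_d -> P1 R d -> R) (Cb : R)
    (rho : 'rV[R]_d -> R) (Cbf : R) : Prop :=
  forall (mu : R -> P1 R d) (N : nat) (dx eps : R),
    continuous_curve T mu -> (0 < N)%N -> 0 < dx -> 0 < eps ->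
  forall t x, 0 <= t <= T ->
    enorm (drift T L F G Cb rho N dx eps mu t x) <= Cbf.

(* Main.v *)
Require Import Defs.
From mathcomp Require Import all_boot all_order all_algebra.
From mathcomp Require Import all_classical all_reals all_analysis.
From mathcomp Require Import measurable_realfun.
From mathcomp Require Import ring lra zify.

(** The measure with density [density t_k] is the law [nu k] of a random point, and
    [nu k.+1] arises from [nu k] by two moves: a point [x] is sent to [flow k x],
    then it is redrawn uniformly in the grid cell that contains [flow k x]. The
    first move has length at most [dt * Cbf] by the bound on the drift, the second
    at most [dx * sqrt d], the Euclidean diameter of a cell. Hence [nu k] and
    [nu k.+1] have a coupling of cost at most
    [dt * Cbf + dx * sqrt d <= (Cbf + c * sqrt d) * dt].

    Couplings are composed rather than distances: a coupling of [nu j] and [nu k] is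
    extended to one of [nu j] and [nu k.+1] by applying the random move to its second
    point ([transport_scatter]). Between two grid times the law is a mixture of
    [nu k] and [nu k.+1], and mixtures of couplings are couplings of mixtures; as
    all the costs are affine in the weights, the Lipschitz constant is unchanged
    ([transport_interpolant]).

    The laws and the scheme agree because redrawing only depends on the cell
    reached: [nu k.+1 B] is the sum over the cells [E] of the probability
    [nu k (flow k @^-1` E)] times the proportion of [E] covered by [B]
    ([scatter_law]). On [B = E] this is the recursion defining the masses ([massE]).
    Finite first moments propagate because the moves have bounded length.

    All of this requires the flow to be Borel. Its two ingredients are the gradient
    of the mollified value function, and the gradient in [p] of the Hamiltonian. A
    gradient is a limit of difference quotients, and [measurable_lim_at0] shows that
    such a limit is measurable as soon as the quotients are measurable in space and
    continuous in the increment, [lim] being constant where the limit does not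
    exist. The mollified value function is the convolution of an integrable kernel
    with a bounded function that is Lipschitz at small distances, hence it is
    continuous. The Hamiltonian is finite because the Lagrangian is strongly convex
    in the control; being convex in [p], it is then continuous along lines, and it
    is measurable because rational controls suffice in the supremum. *)

Set Implicit Arguments.
Unset Strict Implicit.
Unset Printing Implicit Defensive.
Import Order.TTheory GRing.Theory Num.Theory.
Import numFieldNormedType.Exports.
Local Open Scope classical_set_scope.
Local Open Scope ring_scope.

(** * The Euclidean norm *)

Section euclidean_norm.
Context (R : realType) (d : nat).
Implicit Types x y : 'rV[R]_d.

Lemma dotrv_ge0 x : 0 <= dotrv x x.
Proof. by apply: sumr_ge0 => i _; rewrite -expr2 sqr_ge0. Qed.

Lemma enorm_ge0 x : 0 <= enorm x.
Proof. exact: sqrtr_ge0. Qed.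

Lemma sqr_enorm x : enorm x ^+ 2 = dotrv x x.
Proof. by rewrite sqr_sqrtr ?dotrv_ge0. Qed.

Lemma enorm0 : enorm (0 : 'rV[R]_d) = 0.
Proof.
by rewrite /enorm /dotrv big1 ?sqrtr0// => i _; rewrite mxE mul0r.
Qed.

Lemma enormN x : enorm (- x) = enorm x.
Proof.
rewrite /enorm /dotrv; congr Num.sqrt; apply: eq_bigr => i _.
by rewrite mxE mulrNN.
Qed.

Lemma enormB x y : enorm (x - y) = enorm (y - x).
Proof. by rewrite -enormN opprB. Qed.

Lemma enormZ (a : R) x : enorm (a *: x) = `|a| * enorm x.
Proof.
rewrite /enorm /dotrv -sqrtr_sqr -sqrtrM ?sqr_ge0//; congr Num.sqrt.
by rewrite mulr_sumr; apply: eq_bigr => i _; rewrite !mxE; ring.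
Qed.

Lemma coord_le_enorm x i : `|x 0 i| <= enorm x.
Proof.
rewrite -sqrtr_sqr /enorm ler_sqrt ?dotrv_ge0// /dotrv (bigD1 i)//= -expr2 lerDl.
by apply: sumr_ge0 => j _; rewrite -expr2 sqr_ge0.
Qed.

Lemma enorm_le_coord x (c : R) : 0 <= c -> (forall i, `|x 0 i| <= c) ->
  enorm x <= c * Num.sqrt d%:R.
Proof.
move=> c0 xc; rewrite -[c]ger0_norm// -sqrtr_sqr -sqrtrM ?sqr_ge0//.
rewrite ler_sqrt ?mulr_ge0 ?sqr_ge0 ?ler0n// /dotrv.
rewrite mulr_natr -[d in X in _ <= X]card_ord -sumr_const; apply: ler_sum => i _.
by rewrite -expr2 -real_normK ?num_real// lerXn2r ?nnegrE.
Qed.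

Lemma dotrv_le_enorm x y : dotrv x y <= enorm x * enorm y.
Proof.
have [x0|x0] := eqVneq (enorm x) 0.
  rewrite x0 mul0r /dotrv big1// => i _.
  have := coord_le_enorm x i; rewrite x0 normr_le0 => /eqP ->.
  by rewrite mul0r.
have [y0|y0] := eqVneq (enorm y) 0.
  rewrite y0 mulr0 /dotrv big1// => i _.
  have := coord_le_enorm y i; rewrite y0 normr_le0 => /eqP ->.
  by rewrite mulr0.
have : 0 <= dotrv (enorm y *: x - enorm x *: y) (enorm y *: x - enorm x *: y).
  exact: dotrv_ge0.
have -> : dotrv (enorm y *: x - enorm x *: y) (enorm y *: x - enorm x *: y) =
  2 * (enorm x * enorm y) * (enorm x * enorm y - dotrv x y).
  transitivity (enorm y ^+ 2 * dotrv x x + enorm x ^+ 2 * dotrv y y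
      - 2 * (enorm x * enorm y) * dotrv x y); last by rewrite -!sqr_enorm; ring.
  rewrite /dotrv !mulr_sumr -sumrN -!big_split/=; apply: eq_bigr => i _.
  by rewrite !mxE; ring.
by rewrite pmulr_rge0 ?subr_ge0// mulr_gt0// mulr_gt0// lt0r ?x0 ?y0 enorm_ge0.
Qed.

Lemma ler_enormD x y : enorm (x + y) <= enorm x + enorm y.
Proof.
rewrite -(@ler_pXn2r _ 2%N)// ?nnegrE ?addr_ge0 ?enorm_ge0//.
rewrite sqrrD !sqr_enorm.
have -> : dotrv (x + y) (x + y) = dotrv x x + dotrv x y *+ 2 + dotrv y y.
  rewrite /dotrv -sumrMnl -!big_split/=; apply: eq_bigr => i _.
  by rewrite !mxE; ring.
by rewrite lerD2r lerD2l lerMn2r/= dotrv_le_enorm.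
Qed.

Lemma ler_enorm_distD y x z : enorm (x - z) <= enorm (x - y) + enorm (y - z).
Proof. by rewrite -[x - z](subrKA y) ler_enormD. Qed.

Lemma measurable_enorm : measurable_fun setT (@enorm R d).
Proof.
apply: (@measurableT_comp _ _ _ _ _ _ (@Num.sqrt R)).
  by apply: continuous_measurable_fun; exact: sqrt_continuous.
by apply: measurable_sum => i; apply: measurable_funM; exact: measurable_coord.
Qed.

End euclidean_norm.

(** * Images, mixtures and products of probability measures *)

Section probability_constructions.
Local Open Scope ereal_scope.
Context (R : realType).

Lemma measure_probability dX (X : measurableType dX)
    (m : {measure set X -> \bar R}) : m setT = 1 ->
  exists P : probability X R, P = m :> (set X -> \bar R).
Proof.
move=> m1; exists (mnormalize m (dirac point)); apply/funext => A.
by rewrite /= /mnormalize m1/= onee_eq0/= invr1 mule1.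
Qed.

Lemma image_probability dX dY (X : measurableType dX) (Y : measurableType dY)
    (P : probability X R) (f : X -> Y) : measurable_fun setT f ->
  exists Q : probability Y R,
    (forall A, Q A = P (f @^-1` A)) /\
    (forall h : Y -> \bar R, measurable_fun setT h -> (forall y, 0 <= h y) ->
      \int[Q]_y h y = \int[P]_x h (f x)).
Proof.
move=> mf.
pose m : {measure set Y -> \bar R} :=
  measure_function_pushforward__canonical__measure_function_Measure P mf.
have [|Q QE] := @measure_probability _ _ m.
  by rewrite /m/= /pushforward preimage_setT probability_setT.
exists Q; split=> [A|h mh h0]; first by rewrite QE.
transitivity (\int[pushforward P f]_y h y); last first.
  by rewrite ge0_integral_pushforward// preimage_setT.
by apply: eq_measure_integral => A mA _ /=; rewrite QE.
Qed.

Lemma mixture_probability dX (X : measurableType dX)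
    (P Q : probability X R) (w : R) : (0 <= w <= 1)%R ->
  exists S : probability X R,
    (forall A, S A = (1 - w)%:E * P A + w%:E * Q A) /\
    (forall h : X -> \bar R, measurable_fun setT h -> (forall y, 0 <= h y) ->
      \int[S]_y h y = (1 - w)%:E * \int[P]_x h x + w%:E * \int[Q]_x h x).
Proof.
move=> /andP[w0 w1].
have w1' : (0 <= 1 - w)%R by rewrite subr_ge0.
pose m := measure_add (mscale (NngNum w1') P) (mscale (NngNum w0) Q).
have mE A : m A = (1 - w)%:E * P A + w%:E * Q A by rewrite /m measure_addE.
have [|S SE] := @measure_probability _ _ m.
  apply: (eq_trans (mE setT)).
  have -> : P setT = 1 by exact: probability_setT.
  have -> : Q setT = 1 by exact: probability_setT.
  by rewrite !mule1 -EFinD subrK.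
exists S; split=> [A|h mh h0]; first by rewrite SE; exact: mE.
transitivity (\int[m]_y h y).
  by apply: eq_measure_integral => A mA _ /=; rewrite SE.
by rewrite /m ge0_integral_measure_add// !ge0_integral_mscale.
Qed.

Lemma product_probability dX dY (X : measurableType dX) (Y : measurableType dY)
    (P : probability X R) (Q : probability Y R) :
  exists S : probability (X * Y)%type R,
    (forall A, S A = \int[P]_x Q (xsection A x)) /\
    (forall h : X * Y -> \bar R, measurable_fun setT h -> (forall y, 0 <= h y) ->
      \int[S]_z h z = \int[P]_x \int[Q]_y h (x, y)).
Proof.
have [|S SE] := @measure_probability _ _ (P \x Q)%E.
  rewrite -setXTT.
  apply: (eq_trans (product_measure1E P Q measurableT measurableT)).
  by rewrite -[RHS]mule1; congr (_ * _); exact: probability_setT.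
exists S; split=> [A|h mh h0]; first by rewrite SE.
rewrite -[RHS](fubini_tonelli1 _ mh h0).
by apply: eq_measure_integral => A mA _ /=; rewrite SE.
Qed.

End probability_constructions.

(** * Affine changes of variables *)

Section affine_change.
Context (R : realType).

Lemma mule_rescale (c k l : R) (x y : \bar R) : c * (k * l) = 1 ->
  (c%:E * ((k%:E * x) * (l%:E * y)) = x * y)%E.
Proof. by move=> ckl; rewrite muleACA -EFinM [LHS]muleA -EFinM ckl mul1e. Qed.

(** Both sides are measures in [A] that agree on the intervals ]x, y], and these
    determine the Lebesgue measure. *)
Lemma lebesgue_measure_affine (a b : R) (A : set (measurableTypeR R)) :
  0 < a -> measurable A ->
  lebesgue_measure ((fun x => a * x + b) @^-1` A) =
  (a^-1%:E * lebesgue_measure A)%E.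
Proof.
move=> a0 mA.
have mf : measurable_fun setT (fun x => a * x + b : measurableTypeR R).
  by apply: measurable_funD => //; exact: measurable_funM.
pose m : {measure set (measurableTypeR R) -> \bar R} :=
  measure_function_pushforward__canonical__measure_function_Measure
    lebesgue_measure mf.
pose m' : {measure set (measurableTypeR R) -> \bar R} :=
  mscale (NngNum (ltW a0)) m.
have -> : lebesgue_measure A = m' A.
  apply: lebesgue_measure_unique => // _ [[x y] _ <-] /=.
  rewrite lebesgue_measure_itv /= /m' /= /mscale /m /= /pushforward.
  rewrite (_ : _ @^-1` _ = `](x - b) / a, (y - b) / a]%classic); last first.
    apply/seteqP; split=> z /=; rewrite !in_itv/= ltr_pdivrMr// ler_pdivlMr//.
      by rewrite ltrBlDr lerBrDr mulrC.
    by rewrite ltrBlDr lerBrDr mulrC.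
  rewrite lebesgue_measure_itv /= !lte_fin ltr_pM2r ?invr_gt0// ltrD2r.
  case: ifPn => _; last by rewrite mule0.
  by rewrite -!EFinB -EFinM; congr EFin; field; exact: lt0r_neq0.
rewrite /m' /= /mscale /= muleA -EFinM mulVf ?lt0r_neq0// mul1e.
by [].
Qed.

Lemma measurable_affine_rV (n : nat) (a : R) (b : 'rV[R]_n) :
  measurable_fun setT (fun x : 'rV[R]_n => a *: x + b).
Proof.
apply: measurable_fun_rV => i.
under eq_fun do rewrite !mxE.
apply: measurable_funD => //; apply: measurable_funM => //.
exact: measurable_coord.
Qed.

(** The affine map acts separately on the first coordinate and on the others, so
    the induction step compares two measures on a product that agree on the
    rectangles. Translations are used to move one cell onto another, dilations to
    rescale the mollifier. *)
Lemma lebesgue_rV_affine (n : nat) (a : R) (b : 'rV[R]_n) (A : set 'rV[R]_n) :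
  0 < a -> measurable A ->
  lebesgue_rV R n ((fun x => a *: x + b) @^-1` A) =
  ((a ^- n)%:E * lebesgue_rV R n A)%E.
Proof.
move=> a0; elim: n b A => [|n IHn] b A mA.
  rewrite expr0 invr1 mul1e; congr (lebesgue_rV R 0 _); apply/seteqP.
  by split=> x; rewrite /preimage/= (_ : a *: x + b = x)//; apply/rowP => -[].
pose b' : 'rV[R]_n := \row_j b 0 (lift 0 j).
pose f (z : measurableTypeR R * 'rV[R]_n) : measurableTypeR R * 'rV[R]_n :=
  (a * z.1 + b 0 0, a *: z.2 + b').
have mf1 : measurable_fun setT
    (fun x : measurableTypeR R => a * x + b 0 0 : measurableTypeR R).
  by apply: measurable_funD => //; exact: measurable_funM.
have mf2 := @measurable_affine_rV n a b'.
have mf : measurable_fun setT f.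
  apply/measurable_fun_pairP; split.
    exact: (measurableT_comp mf1 measurable_fst).
  exact: (measurableT_comp mf2 measurable_snd).
have fK z : a *: consrV z + b = consrV (f z).
  apply/rowP => i; case: (unliftP 0 i) => [j ->|->]; rewrite mxE [in LHS]mxE.
    by rewrite !consrVS !mxE.
  by rewrite !consrV0.
pose m : {measure set (measurableTypeR R * 'rV[R]_n) -> \bar R} :=
  measure_function_pushforward__canonical__measure_function_Measure
    (lebesgue_measure \x lebesgue_rV R n)%E mf.
pose m' : {measure set (measurableTypeR R * 'rV[R]_n) -> \bar R} :=
  mscale (NngNum (ltW (exprn_gt0 n.+1 a0))) m.
have mB : measurable (@consrV R n @^-1` A).
  by rewrite -[X in measurable X]setTI; exact: measurable_consrV.
have H : (lebesgue_measure \x lebesgue_rV R n)%E (@consrV R n @^-1` A) =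
    m' (@consrV R n @^-1` A).
  apply: product_measure_unique => // X Y mX mY.
  rewrite /m' /= /mscale /m /= /pushforward.
  rewrite (_ : f @^-1` (X `*` Y) =
    ((fun x => a * x + b 0 0) @^-1` X) `*` ((fun x => a *: x + b') @^-1` Y))//.
  rewrite product_measure1E//.
  - transitivity ((a ^+ n.+1)%:E * ((a^-1%:E * lebesgue_measure X) *
        ((a ^- n)%:E * lebesgue_rV R n Y)))%E.
      congr (_ * (_ * _))%E; last exact: IHn.
      exact: lebesgue_measure_affine.
    apply: mule_rescale; rewrite -invfM -exprS divff//.
    by rewrite expf_neq0// lt0r_neq0.
  - by rewrite -[X in measurable X]setTI; exact: mf1.
  - by rewrite -[X in measurable X]setTI; exact: mf2.
change ((lebesgue_measure \x lebesgue_rV R n)%E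
   (@consrV R n @^-1` ((fun x : 'rV_n.+1 => a *: x + b) @^-1` A)) =
  ((a ^- n.+1)%:E * (lebesgue_measure \x lebesgue_rV R n)%E (@consrV R n @^-1` A))%E).
rewrite H /m' /= /mscale /= muleA -EFinM mulVf ?mul1e; last first.
  by rewrite expf_neq0// lt0r_neq0.
rewrite /pushforward; congr (_ _).
by apply/seteqP; split=> z; rewrite /preimage/= fK.
Qed.

End affine_change.

(** * Functions with countably many measurable fibers *)

Section countable_fibers.
Context dX (X : measurableType dX) (R : realType) (I : countType) (idx : X -> I).
Hypothesis mfiber : forall i, measurable (idx @^-1` [set i]).

Lemma measurable_countable_factor dY (Y : measurableType dY) (g : I -> Y) :
  measurable_fun setT (g \o idx).
Proof.
move=> _ B mB; rewrite setTI.
rewrite (_ : _ @^-1` B = \bigcup_(i in [set i | B (g i)]) (idx @^-1` [set i])).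
  rewrite bigcup_mkcond; apply: countable_bigcupT_measurable => // i.
  by case: ifP => // _.
apply/seteqP; split=> [x /= Bx|x [i /= Bi xi]]; first by exists (idx x).
by rewrite xi.
Qed.

(** The canonical encoding of [I] in the natural numbers turns the unordered sum
    into a series; numbers that encode nothing contribute 0. *)
Lemma esum_countable (a : I -> \bar R) : (forall i, 0 <= a i)%E ->
  (\esum_(i in setT) a i =
   \sum_(n <oo) (if @pickle_inv I n is Some i then a i else 0))%E.
Proof.
move=> a0.
pose b n := if @pickle_inv I n is Some i then a i else 0%E.
have b0 n : (0 <= b n)%E by rewrite /b; case: (@pickle_inv I n).
rewrite nneseries_esumT//.
transitivity (\esum_(n in pickle @` [set: I]) b n).
  have pI : set_inj [set: I] (@pickle I).
    by move=> i j _ _; exact: (pcan_inj (@choice.pickleK I)).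
  rewrite esum_image //.
  by apply: eq_esum => i _; rewrite /b pickleK_inv.
rewrite esum_mkcond; apply: eq_esum => n _; case: ifPn => // /negP nI.
rewrite /b; case E : (@pickle_inv I n) => [i|//]; exfalso; apply: nI.
rewrite inE; exists i => //; have := @pickle_invK I n.
by rewrite /oapp E.
Qed.

(** The fibers of [idx] cut [D] into countably many measurable pieces on which the
    integrand is constant. *)
Lemma integral_countable_factor (mu : {measure set X -> \bar R}) (D : set X)
    (h : I -> \bar R) : measurable D -> (forall i, 0 <= h i)%E ->
  (\int[mu]_(x in D) h (idx x) =
   \esum_(i in setT) (h i * mu (D `&` idx @^-1` [set i])))%E.
Proof.
move=> mD h0; rewrite esum_countable; last first.
  by move=> i; rewrite mule_ge0.
pose F n := D `&` (pickle \o idx) @^-1` [set n].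
have mF n : measurable (F n).
  apply: measurableI => //.
  rewrite (_ : _ @^-1` _ = (if @pickle_inv I n is Some i then idx @^-1` [set i] else set0)).
    by case: (@pickle_inv I n).
  apply/seteqP; split=> x /=; first by move=> <-; rewrite pickleK_inv.
  case E : (@pickle_inv I n) => [i|//] /= ->.
  by have := @pickle_invK I n; rewrite /oapp E.
have DF : D = \bigcup_n F n.
  apply/seteqP; split=> [x Dx|x [n _ []//]].
  by exists (pickle (idx x)).
rewrite [in LHS]DF ge0_integral_bigcup//.
- apply: eq_eseriesr => n _; rewrite /F.
  case E : (@pickle_inv I n) => [i|]; last first.
    rewrite (_ : _ `&` _ = set0) ?integral_set0//.
    apply/seteqP; split=> // x [Dx /= xn].
    by move: E; rewrite -xn pickleK_inv.
  have -> : (pickle \o idx) @^-1` [set n] = idx @^-1` [set i].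
    apply/seteqP; split=> x /=; first by move=> xn; move: E; rewrite -xn pickleK_inv => -[].
    by move=> ->; have := @pickle_invK I n; rewrite /oapp E.
  rewrite (_ : \int[mu]_(x in _) h (idx x) =
     \int[mu]_(x in D `&` idx @^-1` [set i]) h i)%E.
    by rewrite integral_cst//; exact: measurableI.
  by apply: eq_integral => x /[!inE] -[_ /= ->].
- apply: measurable_funTS; exact: (@measurable_countable_factor _ _ h).
- apply/trivIsetP => m n _ _ mn; rewrite -subset0 => x [[_ /= xm] [_ /= xn]].
  by move/eqP: mn; apply; rewrite -xm -xn.
Qed.

End countable_fibers.

(** * Redrawing a point uniformly in its cell *)

Section cells.
Context (R : realType) (d : nat) (dx : R).
Hypothesis dx0 : 0 < dx.
Implicit Types (i : 'rV[int]_d) (x y u : 'rV[R]_d).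

(** The cells tile the space by half-open cubes centred at the nodes, so the cell
    of a point is found by rounding each coordinate. *)
Definition cell_index x : 'rV[int]_d := \row_l Num.floor (x 0 l / dx + 2^-1).

Lemma cell_indexE i : cell_index @^-1` [set i] = cell dx i.
Proof.
have E (a : R) (z : int) :
    (Num.floor (a / dx + 2^-1) == z) = (- (dx / 2) <= a - z%:~R * dx < dx / 2).
  have dxn0 : dx != 0 by rewrite lt0r_neq0.
  rewrite floor_eq intrD -[z%:~R <= _]subr_ge0 -[_ + _ < _]subr_gt0.
  rewrite -[- (dx / 2) <= _]subr_ge0 -[_ - _ < dx / 2]subr_gt0.
  rewrite (_ : a - _ - - _ = (a / dx + 2^-1 - z%:~R) * dx); last by field.
  rewrite (_ : dx / 2 - _ = (z%:~R + 1 - (a / dx + 2^-1)) * dx); last by field.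
  by rewrite pmulr_lge0// pmulr_lgt0.
apply/seteqP; split=> x /=.
  by move=> <- l; rewrite !mxE -E.
move=> xi; apply/rowP => l; rewrite mxE; apply/eqP; rewrite E.
by have := xi l; rewrite !mxE.
Qed.

Lemma cell_indexP i x : cell dx i x <-> cell_index x = i.
Proof. by rewrite -cell_indexE. Qed.

Lemma cell_boxE i : cell dx i = [set x | forall l,
  ([set` `[(i 0 l)%:~R * dx - dx / 2, (i 0 l)%:~R * dx + dx / 2[] : set R) (x 0 l)].
Proof.
apply/seteqP; split=> x /= xi l; have := xi l; rewrite !mxE in_itv/=.
  by rewrite lerBrDl ltrBlDl.
by rewrite lerBrDl ltrBlDl.
Qed.

Lemma measurable_cell i : measurable (cell dx i).
Proof.
rewrite (_ : cell dx i = \bigcap_(l in [set: 'I_d])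
  ((fun x : 'rV[R]_d => x 0 l : measurableTypeR R) @^-1`
   [set` `[(i 0 l)%:~R * dx - dx / 2, (i 0 l)%:~R * dx + dx / 2[])).
  apply: fin_bigcap_measurable => [|l _]; first exact: finite_finset.
  by rewrite -[X in measurable X]setTI; exact: measurable_coord.
rewrite cell_boxE; apply/seteqP; split=> x xi l; first by move=> _; exact: xi.
exact: (xi l Logic.I).
Qed.

Lemma lebesgue_cell i : lebesgue_rV R d (cell dx i) = (dx ^+ d)%:E.
Proof.
rewrite cell_boxE.
apply: (eq_trans (lebesgue_rV_box (fun l => @measurable_itv R
  `[(i 0 l)%:~R * dx - dx / 2, (i 0 l)%:~R * dx + dx / 2[))).
rewrite (eq_bigr (fun=> dx%:E)); last first.
  move=> l _; rewrite lebesgue_measure_itv/= lte_fin.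
  rewrite ifT; last by rewrite ltrD2l gtrN// divr_gt0.
  by rewrite -EFinB; congr EFin; field.
by rewrite -[in RHS](card_ord d) -prodr_const prodEFin.
Qed.

Let mfiber i : measurable (cell_index @^-1` [set i]).
Proof. by rewrite cell_indexE; exact: measurable_cell. Qed.

Definition cell_center x : 'rV[R]_d := node dx (cell_index x).

Lemma measurable_cell_center : measurable_fun setT cell_center.
Proof. exact: (measurable_countable_factor mfiber (node dx)). Qed.

Lemma cell_center_dist x l : `|(x - cell_center x) 0 l| <= dx / 2.
Proof.
have /(_ l) := (cell_indexP (cell_index x) x).2 erefl.
by rewrite ler_norml => /andP[-> /ltW].
Qed.

(** The second argument carries the randomness: only the position of [u] relative
    to the centre of its own cell is used, so that the result stays in the cell of
    [x] for every [u], and not just for [u] in the cell centred at 0. *)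
Definition cell_scatter x u : 'rV[R]_d := cell_center x + (u - cell_center u).

(** Both points differ from the centre of their common cell by at most [dx / 2] in
    each coordinate. *)
Lemma cell_scatter_dist x u : enorm (cell_scatter x u - x) <= dx * Num.sqrt d%:R.
Proof.
apply: enorm_le_coord => [|l]; first exact: ltW.
rewrite (_ : _ - _ = (u - cell_center u) - (x - cell_center x)); last first.
  by apply/rowP => j; rewrite !mxE; ring.
rewrite mxE [X in _ + X]mxE (le_trans (ler_normB _ _))// [leRHS]splitr lerD//.
  exact: cell_center_dist.
exact: cell_center_dist.
Qed.

Lemma measurable_cell_scatter dX (X : measurableType dX) (f : X -> 'rV[R]_d) :
  measurable_fun setT f ->
  measurable_fun setT (fun z : X * 'rV[R]_d => cell_scatter (f z.1) z.2).
Proof.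
move=> mf; apply: measurable_fun_rV => l.
have sE x u : cell_scatter x u 0 l = cell_center x 0 l + (u 0 l - cell_center u 0 l).
  by rewrite /cell_scatter mxE; congr (_ + _); rewrite mxE; congr (_ + _); rewrite mxE.
under eq_fun do rewrite sE.
have mc : measurable_fun setT (fun x : 'rV[R]_d => cell_center x 0 l : measurableTypeR R).
  by apply: (measurableT_comp (@measurable_coord R d l)); exact: measurable_cell_center.
apply: measurable_funD.
  exact: (measurableT_comp mc (measurableT_comp mf measurable_fst)).
apply: measurable_funB.
  exact: (measurableT_comp (@measurable_coord R d l) measurable_snd).
exact: (measurableT_comp mc measurable_snd).
Qed.

Lemma uniform_cell : exists U : probability 'rV[R]_d R, forall A, measurable A ->
  U A = ((dx ^- d)%:E * lebesgue_rV R d (A `&` cell dx 0))%E.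
Proof.
have mc := measurable_cell 0.
have c0 : 0 <= dx ^- d by rewrite invr_ge0 exprn_ge0// ltW.
pose m : {measure set 'rV[R]_d -> \bar R} :=
  mscale (NngNum c0) (mrestr (lebesgue_rV R d) mc).
have [|U UE] := @measure_probability _ _ _ m.
  change ((dx ^- d)%:E * lebesgue_rV R d (setT `&` cell dx 0) = 1)%E.
  rewrite setTI lebesgue_cell.
  by rewrite -EFinM mulVf// expf_neq0// lt0r_neq0.
by exists U => A mA; rewrite UE.
Qed.

(** The joint law of a random point [w] and of a point drawn uniformly in the cell
    that contains [f w]. The second marginal only sees [f] through the
    probabilities of the cells, which is the form of the recursion that defines
    the scheme; the last clause bounds costs, as [f w] and the new point are in the
    same cell. *)
Lemma scatter_law dX (X : measurableType dX) (P : probability X R)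
    (f : X -> 'rV[R]_d) : measurable_fun setT f ->
  exists S : probability (X * 'rV[R]_d)%type R,
  [/\ forall A, measurable A -> S (A `*` setT) = P A,
      forall B, measurable B -> S (setT `*` B) =
        (\esum_(i in setT) (P (f @^-1` cell dx i) *
           ((dx ^- d)%:E * lebesgue_rV R d (B `&` cell dx i))))%E
    & forall (h : X * 'rV[R]_d -> \bar R) (k : X -> \bar R),
        measurable_fun setT h -> (forall z, 0 <= h z)%E ->
        measurable_fun setT k ->
        (forall w y, enorm (y - f w) <= dx * Num.sqrt d%:R -> (h (w, y) <= k w)%E) ->
        (\int[S]_z h z <= \int[P]_w k w)%E].
Proof.
move=> mf; have [U UE] := uniform_cell.
have [PU [PUE PUi]] := product_probability P U.
pose g (z : X * 'rV[R]_d) := (z.1, cell_scatter (f z.1) z.2).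
have mg : measurable_fun setT g.
  apply/measurable_fun_pairP; split; first exact: measurable_fst.
  exact: measurable_cell_scatter.
have [S [SE Si]] := image_probability PU mg.
have mV A B w : measurable A -> measurable B ->
    measurable (xsection (g @^-1` (A `*` B)) w).
  move=> mA mB; apply: measurable_xsection; rewrite -[X in measurable X]setTI.
  by apply: mg => //; exact: measurableX.
exists S; split.
- move=> A mA; rewrite SE PUE.
  transitivity (\int[P]_w (\1_A w)%:E)%E; last by rewrite integral_indic// setIT.
  apply: eq_integral => w _; rewrite indicE.
  have [wA|wA] := boolP (w \in A).
    rewrite (_ : xsection _ _ = setT) ?probability_setT//.
    by apply/seteqP; split=> u // _; apply/xsectionP; split=> //; exact: set_mem.
  rewrite (_ : xsection _ _ = set0) ?measure0//.
  apply/seteqP; split=> u //= /xsectionP [/= wA' _].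
  by move/negP: wA; apply; exact: mem_set.
- move=> B mB; rewrite SE PUE.
  pose h i := ((dx ^- d)%:E * lebesgue_rV R d (B `&` cell dx i))%E.
  have mfi i : measurable ((cell_index \o f) @^-1` [set i]).
    by rewrite comp_preimage -[X in measurable X]setTI; apply: mf.
  transitivity (\int[P]_w h (cell_index (f w)))%E.
    apply: eq_integral => w _; rewrite UE; last exact: mV.
    rewrite /h; congr (_ * _)%E.
    have mBf : measurable (B `&` cell dx (cell_index (f w))).
      by apply: measurableI => //; exact: measurable_cell.
    have := lebesgue_rV_affine (cell_center (f w)) ltr01 mBf.
    rewrite expr1n invr1 mul1e => <-.
    have cE u : cell dx (cell_index (f w)) (1 *: u + cell_center (f w)) <-> cell dx 0 u.
      rewrite /cell/= /cell_center scale1r addrK.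
      have -> : node dx 0 = 0 :> 'rV[R]_d by apply/rowP => l; rewrite !mxE mul0r.
      by rewrite subr0.
    have sE u : cell dx 0 u -> cell_scatter (f w) u = 1 *: u + cell_center (f w).
      move=> /cell_indexP u0; rewrite /cell_scatter {2}/cell_center u0.
      have -> : node dx 0 = 0 :> 'rV[R]_d by apply/rowP => l; rewrite !mxE mul0r.
      by rewrite subr0 scale1r addrC.
    congr (_ _); apply/seteqP; split=> u /=.
      move=> [/xsectionP /= []]; rewrite /g/= => _ + u0.
      by rewrite sE// => Bu; split=> //; exact/cE.
    by move=> [Bu /cE u0]; split=> //; apply/xsectionP; split=> //=; rewrite sE.
  rewrite (@integral_countable_factor _ _ _ _ _ mfi)//; last first.
    by move=> i; rewrite mule_ge0// lee_fin invr_ge0 exprn_ge0// ltW.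
  apply: eq_esum => i _; rewrite setTI muleC; congr (P _ * _)%E.
  by rewrite comp_preimage cell_indexE.
- move=> h k mh h0 mk hk; rewrite Si// PUi//; last exact: (measurableT_comp mh mg).
  apply: ge0_le_integral => //.
  + by move=> w _; apply: integral_ge0.
  + apply: (@measurable_fun_fubini_tonelli_F _ _ _ _ _ U (h \o g)) => //=.
    exact: (measurableT_comp mh mg).
  + move=> w _; have kw u : (h (g (w, u)) <= k w)%E by apply: hk; exact: cell_scatter_dist.
    apply: (@le_trans _ _ (\int[U]_u (k w))%E).
      apply: ge0_le_integral => //.
        apply: (measurableT_comp mh); apply: (measurableT_comp mg).
        exact: measurable_pair1.
      have U1 : U setT = 1%E by exact: probability_setT.
      by rewrite integral_cst//= [X in (_ * X <= _)%E]U1 mule1.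
Qed.

End cells.

(** * Couplings of bounded cost *)

Section transport.
Context (R : realType) (d : nat).
Implicit Types (nu : set 'rV[R]_d -> \bar R) (P : probability 'rV[R]_d R).
Let E2 := ('rV[R]_d * 'rV[R]_d)%type.

(** Stated for set functions, so that a mixture of laws can be given by its formula. *)
Definition transport nu nu' (c : R) : Prop :=
  exists pi : probability ('rV[R]_d * 'rV[R]_d)%type R,
    (forall A, measurable A -> pi (A `*` setT) = nu A /\ pi (setT `*` A) = nu' A) /\
    (\int[pi]_z (enorm (z.1 - z.2))%:E <= c%:E)%E.

Lemma measurable_dist : measurable_fun setT (fun z : E2 => (enorm (z.1 - z.2))%:E).
Proof.
apply/measurable_EFinP; apply: (measurableT_comp (@measurable_enorm R d)).
apply: measurable_fun_rV => i.
have E (z : E2) : (z.1 - z.2) 0 i = z.1 0 i - z.2 0 i by rewrite !mxE.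
under eq_fun do rewrite E.
apply: measurable_funB.
  exact: (measurableT_comp (@measurable_coord R d i) measurable_fst).
exact: (measurableT_comp (@measurable_coord R d i) measurable_snd).
Qed.

Let dist_ge0 (z : E2) : (0 <= (enorm (z.1 - z.2))%:E)%E.
Proof. by rewrite lee_fin enorm_ge0. Qed.

Lemma eq_transport nu1 nu1' nu2 nu2' c :
  (forall A, measurable A -> nu1 A = nu2 A) ->
  (forall A, measurable A -> nu1' A = nu2' A) ->
  transport nu1 nu1' c -> transport nu2 nu2' c.
Proof.
move=> e e' [pi [pi12 pic]]; exists pi; split=> // A mA.
by rewrite -e// -e'//; exact: pi12.
Qed.

Lemma transport_refl P : transport P P 0.
Proof.
have mdiag : measurable_fun setT (fun x : 'rV[R]_d => (x, x)).
  by apply/measurable_fun_pairP; split; exact: measurable_id.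
have [pi [piE pii]] := image_probability P mdiag.
exists pi; split=> [A mA|].
  by rewrite !piE; split; congr (P _); apply/seteqP; split=> x //= [].
rewrite (pii _ measurable_dist dist_ge0).
by rewrite integral0_eq// => x _ /=; rewrite subrr enorm0.
Qed.

Lemma transport_sym nu nu' c : transport nu nu' c -> transport nu' nu c.
Proof.
move=> [pi [pi12 pic]].
have mswap : measurable_fun setT (fun z : E2 => (z.2, z.1)).
  apply/measurable_fun_pairP; split; first exact: measurable_snd.
  exact: measurable_fst.
have [pi' [piE pii]] := image_probability pi mswap.
exists pi'; split=> [A mA|].
  have [p1 p2] := pi12 _ mA; rewrite !piE -p1 -p2.
  by split; congr (pi _); apply/seteqP; split=> -[x y] /= [].
rewrite (pii _ measurable_dist dist_ge0).
by under eq_integral do rewrite /= enormB.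
Qed.

(** Mixing the couplings with the same weights couples the mixtures, and the cost
    is affine in the weights. *)
Lemma transport_mixture nu1 nu1' nu2 nu2' (c1 c2 w : R) : 0 <= w <= 1 ->
  transport nu1 nu1' c1 -> transport nu2 nu2' c2 ->
  transport (fun A => (1 - w)%:E * nu1 A + w%:E * nu2 A)%E
            (fun A => (1 - w)%:E * nu1' A + w%:E * nu2' A)%E
            ((1 - w) * c1 + w * c2).
Proof.
move=> w01 [pi1 [p1 i1]] [pi2 [p2 i2]].
have [pi [piE pii]] := mixture_probability pi1 pi2 w01.
exists pi; split=> [A mA|].
  by rewrite !piE; have [-> ->] := p1 _ mA; have [-> ->] := p2 _ mA.
rewrite (pii _ measurable_dist dist_ge0).
move: w01 => /andP[w0 w1].
rewrite [leRHS]EFinD [in leRHS]EFinM [((w * c2)%:E)%E]EFinM.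
by rewrite leeD// lee_wpmul2l// lee_fin// subr_ge0.
Qed.

(** The coupling is extended by moving its second point, which costs at most the
    displacement of that point. Extending couplings step by step takes the place of
    the triangle inequality for [d1]. *)
Lemma transport_scatter (dx K c : R) nu P (P' : set 'rV[R]_d -> \bar R)
    (f : 'rV[R]_d -> 'rV[R]_d) : 0 < dx -> measurable_fun setT f ->
  (forall x, enorm (f x - x) <= K) ->
  (forall B, measurable B -> P' B =
     (\esum_(i in setT) (P (f @^-1` cell dx i) *
        ((dx ^- d)%:E * lebesgue_rV R d (B `&` cell dx i))))%E) ->
  transport nu P c -> transport nu P' (c + (K + dx * Num.sqrt d%:R)).
Proof.
move=> dx0 mf fK P'E [pi [pi12 pic]].
have mf2 : measurable_fun setT (fun z : E2 => f z.2).
  exact: (measurableT_comp mf measurable_snd).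
have [S [S1 S2 Sle]] := scatter_law dx0 pi mf2.
have mg : measurable_fun setT (fun z : E2 * 'rV[R]_d => (z.1.1, z.2)).
  apply/measurable_fun_pairP; split; last exact: measurable_snd.
  exact: (measurableT_comp measurable_fst measurable_fst).
have [Q [QE Qi]] := image_probability S mg.
exists Q; split=> [A mA|].
  rewrite !QE; split.
    have [<- _] := pi12 _ mA; rewrite -S1; last exact: measurableX.
    by congr (S _); apply/seteqP; split=> -[[x y] z] //= [].
  rewrite P'E// (_ : _ @^-1` _ = setT `*` A); last first.
    by apply/seteqP; split=> -[[x y] z] //= [].
  rewrite S2//; apply: eq_esum => i _; congr (_ * _)%E.
  have mfi : measurable (f @^-1` cell dx i).
    by rewrite -[X in measurable X]setTI; apply: mf => //; exact: measurable_cell.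
  have [_ <-] := pi12 _ mfi.
  by congr (pi _); apply/seteqP; split=> -[x y] //= [].
have K0 : 0 <= K by rewrite (le_trans _ (fK 0))// enorm_ge0.
have C0 : 0 <= K + dx * Num.sqrt d%:R by rewrite addr_ge0// mulr_ge0 ?sqrtr_ge0// ltW.
rewrite (Qi _ measurable_dist dist_ge0).
apply: (@le_trans _ _ (\int[pi]_z ((enorm (z.1 - z.2))%:E
    + (K + dx * Num.sqrt d%:R)%:E))%E).
  apply: Sle => //=.
  - exact: (measurableT_comp measurable_dist mg).
  - by move=> z; rewrite lee_fin enorm_ge0.
  - by apply: emeasurable_funD; [exact: measurable_dist|exact: measurable_cst].
  - move=> [x y] z /= zf; rewrite -EFinD lee_fin.
    rewrite (le_trans (ler_enorm_distD y _ _))// lerD2l.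
    rewrite (le_trans (ler_enorm_distD (f y) _ _))// enormB lerD//.
    by rewrite enormB.
rewrite ge0_integralD//=; [|exact: measurable_dist].
rewrite integral_cst//=; have -> : pi setT = 1%E by exact: probability_setT.
by rewrite mule1 [leRHS]EFinD leeD.
Qed.

Lemma d1_le_transport (nu nu' : P1 R d) c : transport nu nu' c ->
  (d1 nu nu' <= c%:E)%E.
Proof.
move=> [pi [pi12 pic]]; apply: le_trans pic.
by apply: ereal_inf_lbound; exists pi.
Qed.

End transport.

(** * Affine interpolation of laws in time *)

Section interpolation.
Context (R : realType) (d : nat) (nu : nat -> probability 'rV[R]_d R).
Context (M : nat) (C : R).
Hypothesis chain : forall j l, (j <= l <= M)%N ->
  transport (nu j) (nu l) ((l%:R - j%:R) * C).

Definition interpolant (tau : R) (A : set 'rV[R]_d) : \bar R :=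
  let k := Num.truncn tau in let theta := tau - k%:R in
  ((1 - theta)%:E * nu k A + theta%:E * nu k.+1 A)%E.

Let fin (k : nat) (A : set 'rV[R]_d) : measurable A -> {a | nu k A = a%:E}.
Proof.
by move=> mA; exists (fine (nu k A)); rewrite fineK// fin_num_measure.
Qed.

Lemma theta_itv (tau : R) : 0 <= tau ->
  0 <= tau - (Num.truncn tau)%:R < 1.
Proof.
by move=> t0; have /andP[a b] := truncn_itv t0; rewrite subr_ge0 a/= ltrBlDl natr1.
Qed.

Let sum1 k A (w : R) : measurable A ->
  (nu k A = (1 - w)%:E * nu k A + w%:E * nu k A)%E.
Proof.
move=> mA; have [a ->] := fin k mA.
by rewrite -!EFinM -EFinD; congr EFin; ring.
Qed.

(** The law [nu j] is regarded as a mixture of itself with itself, matched with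
    the two laws that are interpolated. *)
Lemma transport_to_interpolant j (sigma : R) : 0 <= sigma ->
  (j <= Num.truncn sigma < M)%N ->
  transport (nu j) (interpolant sigma) ((sigma - j%:R) * C).
Proof.
move=> s0 /andP[jl lM]; have /andP[t0 t1] := theta_itv s0.
rewrite /interpolant; set l := Num.truncn sigma in jl lM t0 t1 *.
set w := sigma - l%:R in t0 t1 *.
have w01 : 0 <= w <= 1 by rewrite t0 ltW.
have c1 := chain (_ : (j <= l <= M)%N); have c2 := chain (_ : (j <= l.+1 <= M)%N).
have := transport_mixture w01 (c1 _) (c2 _).
rewrite jl (ltnW lM) (leqW jl) lM => /(_ isT isT).
rewrite (_ : (1 - w) * _ + _ = (sigma - j%:R) * C); last first.
  by rewrite /w -[l.+1%:R]natr1; ring.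
by apply: eq_transport => // A mA; rewrite -sum1.
Qed.

(** Within one time interval, a part of the mass of [nu k] moves to [nu k.+1] and
    the rest stays. Otherwise both laws that are interpolated at time [tau] precede
    those at time [sigma], and the costs from either of them are averaged. *)
Lemma transport_interpolant (tau sigma : R) : 0 <= tau <= sigma ->
  (Num.truncn sigma < M)%N ->
  transport (interpolant tau) (interpolant sigma) ((sigma - tau) * C).
Proof.
move=> /andP[tau0 ts] sM; have s0 := le_trans tau0 ts.
have /andP[t0 t1] := theta_itv tau0.
have := le_truncn ts; rewrite leq_eqVlt => /orP[/eqP kl|kl].
  have /andP[u0 u1] := theta_itv s0.
  rewrite /interpolant -kl in u0 u1 sM *; set k := Num.truncn tau in t0 t1 u0 u1 sM *.
  set w := tau - k%:R in t0 t1 *; set v := sigma - k%:R in u0 u1 *.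
  have wv : w <= v by rewrite lerD2r.
  have w1 : 0 < 1 - w by rewrite subr_gt0.
  (* the share of the mass still following [nu k] that moves to [nu k.+1] *)
  pose r := (v - w) / (1 - w).
  have r01 : 0 <= r <= 1.
    by rewrite divr_ge0 ?subr_ge0 ?(ltW t1)//= ler_pdivrMr// mul1r lerD2r ltW.
  have w01 : 0 <= w <= 1 by rewrite t0 ltW.
  have c2 := chain (_ : (k <= k.+1 <= M)%N).
  have := transport_mixture r01 (transport_refl (nu k)) (c2 _).
  rewrite leqnSn sM => /(_ isT) H.
  have := transport_mixture w01 H (transport_refl (nu k.+1)).
  rewrite (_ : (1 - w) * _ + _ = (sigma - tau) * C); last first.
    have -> : sigma - tau = v - w by rewrite /v /w; ring.
    rewrite -natr1 /r; field; exact: lt0r_neq0.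
  apply: eq_transport => A mA.
    by rewrite -sum1.
  have [a ->] := fin k mA; have [b ->] := fin k.+1 mA.
  rewrite -!EFinM -!EFinD; congr EFin; rewrite /r; field; exact: lt0r_neq0.
have w01 : 0 <= tau - (Num.truncn tau)%:R <= 1 by rewrite t0 ltW.
have c1 := transport_to_interpolant s0 (_ : (Num.truncn tau <= _ < _)%N).
have c2 := transport_to_interpolant s0 (_ : ((Num.truncn tau).+1 <= _ < _)%N).
have := transport_mixture w01 (c1 _) (c2 _).
rewrite kl (ltnW kl) sM => /(_ isT isT).
rewrite (_ : (1 - _) * _ + _ = (sigma - tau) * C); last first.
  by rewrite -[(Num.truncn tau).+1%:R]natr1; ring.
apply: eq_transport => // A mA.
rewrite /interpolant; have [a ->] := fin (Num.truncn sigma) mA.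
have [b ->] := fin (Num.truncn sigma).+1 mA.
by rewrite -!EFinM -!EFinD; congr EFin; ring.
Qed.

End interpolation.

(** * The law of the redrawn point *)

Section scattered_laws.
Context (R : realType) (d : nat) (dx : R).
Hypothesis dx0 : 0 < dx.
Implicit Types (P Q : P1 R d) (f : 'rV[R]_d -> 'rV[R]_d).

(** [Q] is the law of a point drawn uniformly in the cell of [f x], where [x] has
    law [P]. *)
Definition scattered (P : probability 'rV[R]_d R) f (Q : set 'rV[R]_d -> \bar R) :=
  forall B, measurable B -> Q B =
     (\esum_(i in setT) (P (f @^-1` cell dx i) *
        ((dx ^- d)%:E * lebesgue_rV R d (B `&` cell dx i))))%E.

Let dxd0 : 0 <= dx ^- d. Proof. by rewrite invr_ge0 exprn_ge0// ltW. Qed.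

Lemma scattered_exists P f (K : R) : measurable_fun setT f ->
  (forall x, enorm (f x - x) <= K) -> exists Q, scattered P f Q.
Proof.
move=> mf fK; have [S [_ S2 Sle]] := scatter_law dx0 P mf.
have [Q [QE Qi]] := image_probability S (measurable_snd : measurable_fun setT snd).
have QB : scattered P f Q.
  move=> B mB; rewrite QE -S2//; congr (S _).
  by apply/seteqP; split=> -[x y] //= [].
have me : measurable_fun setT (fun x : 'rV[R]_d => (enorm x)%:E).
  by apply/measurable_EFinP; exact: measurable_enorm.
have e0 (x : 'rV[R]_d) : (0 <= (enorm x)%:E)%E by rewrite lee_fin enorm_ge0.
have K0 : 0 <= K by rewrite (le_trans _ (fK 0))// enorm_ge0.
have C0 : 0 <= K + dx * Num.sqrt d%:R by rewrite addr_ge0// mulr_ge0 ?sqrtr_ge0// ltW.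
suff Qm : (\int[Q]_x (enorm x)%:E < +oo)%E by exists (MkP1 Qm).
rewrite (Qi _ me e0).
apply: (@le_lt_trans _ _
    (\int[P]_x ((enorm x)%:E + (K + dx * Num.sqrt d%:R)%:E))%E).
  apply: Sle => [|z|| x y /= yf].
  - exact: (measurableT_comp me measurable_snd).
  - exact: e0.
  - by apply: emeasurable_funD; [exact: me|exact: measurable_cst].
  - rewrite -EFinD lee_fin.
    rewrite -[y](subrK x) addrC (le_trans (ler_enormD _ _))// lerD2l.
    by rewrite (le_trans (ler_enorm_distD (f x) _ _))// addrC lerD.
rewrite ge0_integralD //= integral_cst //=.
rewrite lte_add_pinfty //; first by case: (P).
have -> : P setT = 1%E by exact: probability_setT.
by rewrite mule1 ltry.
Qed.

Lemma scattered_cell P f Q j : scattered P f Q ->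
  Q (cell dx j) = P (f @^-1` cell dx j).
Proof.
move=> /(_ _ (measurable_cell dx j)) ->.
rewrite (esumID [set j])//; last by move=> i _; rewrite !mule_ge0.
rewrite setTI esum_set1; last by rewrite !mule_ge0.
rewrite esum1 ?adde0.
  by rewrite setIid lebesgue_cell// -EFinM mulVf ?mule1// expf_neq0// lt0r_neq0.
move=> i [_ /= ij]; rewrite (_ : _ `&` _ = set0) ?measure0 ?mule0//.
rewrite -subset0 => x [/(cell_indexP dx0) xj /(cell_indexP dx0) xi].
by apply: ij; rewrite -xj -xi.
Qed.

(** Such a law has a constant density on each cell, so the masses of the cells
    determine it. *)
Lemma scattered_cells P f Q B : scattered P f Q -> measurable B ->
  Q B = (\esum_(i in setT) (Q (cell dx i) *
        ((dx ^- d)%:E * lebesgue_rV R d (B `&` cell dx i))))%E.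
Proof.
move=> PQ mB; rewrite (PQ _ mB); apply: eq_esum => i _.
by rewrite (scattered_cell i PQ).
Qed.

Lemma mixture_P1 P Q (w : R) : 0 <= w <= 1 ->
  exists S : P1 R d, forall A, S A = ((1 - w)%:E * P A + w%:E * Q A)%E.
Proof.
move=> w01; have [S [SE Si]] := mixture_probability P Q w01.
suff Sm : (\int[S]_x (enorm x)%:E < +oo)%E by exists (MkP1 Sm).
have me : measurable_fun setT (fun x : 'rV[R]_d => (enorm x)%:E).
  by apply/measurable_EFinP; exact: measurable_enorm.
have e0 (x : 'rV[R]_d) : (0 <= (enorm x)%:E)%E by rewrite lee_fin enorm_ge0.
rewrite (Si _ me e0); move: w01 => /andP[w0 w1].
by rewrite lte_add_pinfty// lte_mul_pinfty// ?lee_fin ?subr_ge0//; exact: P1_moment.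
Qed.

End scattered_laws.

(** * The laws carried by the scheme *)

Section scheme_laws.
Context (R : realType) (d : nat) (T : R).
Context (L : 'rV[R]_d -> 'rV[R]_d -> R) (F G : 'rV[R]_d -> P1 R d -> R).
Context (Cb : R) (rho m0 : 'rV[R]_d -> R) (m0s : P1 R d).
Context (N : nat) (dx eps : R) (mu : R -> P1 R d) (K : R).
Hypothesis dx0 : 0 < dx.
Hypothesis m0E : forall A, measurable A ->
  m0s A = (\int[lebesgue_rV R d]_(x in A) (m0 x)%:E)%E.

Let Phi := flow T L F G Cb rho N dx eps mu.
Let mass_ := mass T L F G Cb rho m0 N dx eps mu.

Hypothesis mPhi : forall k, (k <= N)%N -> measurable_fun setT (Phi k).
Hypothesis PhiK : forall k x, (k <= N)%N -> enorm (Phi k x - x) <= K.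

Let dxd0 : 0 <= dx ^- d. Proof. by rewrite invr_ge0 exprn_ge0// ltW. Qed.

Lemma scheme_laws_exist : exists nu : nat -> P1 R d,
  scattered dx m0s id (nu 0) /\
  forall k, (k <= N)%N -> scattered dx (nu k) (Phi k) (nu k.+1).
Proof.
have [nu0 nu0E] : exists Q : P1 R d, scattered dx m0s id Q.
  apply: (@scattered_exists _ _ _ dx0 m0s id 0) => [|x]; first exact: measurable_id.
  by rewrite subrr enorm0.
have /choice[next nextE] : forall kP : nat * P1 R d, exists Q : P1 R d,
    (kP.1 <= N)%N -> scattered dx kP.2 (Phi kP.1) Q.
  move=> [k P] /=; have [kN|] := boolP (k <= N)%N; last by exists P.
  have [Q QE] := scattered_exists dx0 P (mPhi kN) (fun x => PhiK x kN).
  by exists Q.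
exists (fun k => iteri k (fun j P => next (j, P)) nu0); split=> // k kN.
by have := nextE (k, iteri k (fun j P => next (j, P)) nu0) kN.
Qed.

Variable nu : nat -> P1 R d.
Hypothesis nu_init : scattered dx m0s id (nu 0).
Hypothesis nu_step : forall k, (k <= N)%N -> scattered dx (nu k) (Phi k) (nu k.+1).

Lemma law_cells k B : (k <= N.+1)%N -> measurable B ->
  nu k B = (\esum_(i in setT) (nu k (cell dx i) *
        ((dx ^- d)%:E * lebesgue_rV R d (B `&` cell dx i))))%E.
Proof.
case: k => [|k] kN mB; first exact: (scattered_cells dx0 nu_init mB).
exact: (scattered_cells dx0 (nu_step kN) mB).
Qed.

(** One step of the recursion for the masses integrates over the cells the density
    of [nu k], which is constant on each of them; this is the probability that the
    flow sends a point of law [nu k] into the cell [i]. *)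
Lemma massE k i : (k <= N.+1)%N -> mass_ k i = dx ^- d * fine (nu k (cell dx i)).
Proof.
have mc := @measurable_cell R d dx.
elim: k i => [|k IHk] i kN.
  rewrite /mass_ /= (scattered_cell dx0 i nu_init) /Rintegral; congr (_ * fine _).
  by rewrite -m0E.
rewrite -[LHS]/(dx ^- d * fine (\esum_(j in setT) (mass_ k j *
  \int[lebesgue_rV R d]_(x in cell dx j) beta0 dx i (Phi k x))%:E)).
congr (_ * fine _).
have mP : measurable (Phi k @^-1` cell dx i).
  by rewrite -[X in measurable X]setTI; exact: mPhi.
rewrite (scattered_cell dx0 i (nu_step kN)) law_cells//; last exact: leqW.
apply: eq_esum => j _.
have -> : \int[lebesgue_rV R d]_(x in cell dx j) beta0 dx i (Phi k x) =
    fine (lebesgue_rV R d (Phi k @^-1` cell dx i `&` cell dx j)).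
  rewrite /Rintegral; congr fine.
  rewrite -integral_indic//.
have f1 : nu k (cell dx j) \is a fin_num by rewrite fin_num_measure.
have f2 : lebesgue_rV R d (Phi k @^-1` cell dx i `&` cell dx j) \is a fin_num.
  rewrite ge0_fin_numE// (@le_lt_trans _ _ (lebesgue_rV R d (cell dx j)))//.
    by rewrite le_measure ?inE//; exact: measurableI.
  by rewrite lebesgue_cell// ltry.
rewrite IHk; last exact: leqW.
rewrite EFinM EFinM (fineK f1) (fineK f2).
by rewrite [LHS]muleAC [LHS]muleC muleA.
Qed.

Lemma density_nodeE k x :
  density_node T L F G Cb rho m0 N dx eps mu k x = mass_ k (cell_index dx x).
Proof.
rewrite /density_node (fsbigE [:: cell_index dx x])//.
  rewrite big_cons big_nil in_setT Monoid.mulm1 /beta0 indicE mem_set ?mulr1//.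
  exact/(cell_indexP dx0).
move=> i _; rewrite inE => /eqP ix; rewrite /beta0 indicE memNset ?mulr0//.
by move=> /(cell_indexP dx0) /esym.
Qed.

Lemma integral_density_node k A : (k <= N.+1)%N -> measurable A ->
  (\int[lebesgue_rV R d]_(x in A)
    (density_node T L F G Cb rho m0 N dx eps mu k x)%:E = nu k A)%E.
Proof.
move=> kN mA; rewrite (law_cells kN mA).
under eq_integral do rewrite density_nodeE.
have mfiber i : measurable (cell_index dx @^-1` [set i] : set 'rV[R]_d).
  by rewrite cell_indexE//; exact: measurable_cell.
rewrite (@integral_countable_factor _ _ _ _ _ mfiber _ _ (fun i => (mass_ k i)%:E))//.
  apply: eq_esum => i _; rewrite massE// cell_indexE// EFinM fineK.
    by rewrite muleA [(nu _ _ * _)%E]muleC.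
  by rewrite fin_num_measure//; exact: measurable_cell.
by move=> i; rewrite massE// lee_fin mulr_ge0// fine_ge0.
Qed.

Lemma density_node_ge0 k x : (k <= N.+1)%N ->
  0 <= density_node T L F G Cb rho m0 N dx eps mu k x.
Proof. by move=> kN; rewrite density_nodeE massE// mulr_ge0// fine_ge0. Qed.

Lemma measurable_density_node k :
  measurable_fun setT (density_node T L F G Cb rho m0 N dx eps mu k).
Proof.
have mfiber i : measurable (cell_index dx @^-1` [set i] : set 'rV[R]_d).
  by rewrite cell_indexE//; exact: measurable_cell.
rewrite (_ : density_node _ _ _ _ _ _ _ _ _ _ _ _ = mass_ k \o cell_index dx).
  exact: (measurable_countable_factor mfiber).
by apply/funext => x; rewrite density_nodeE.
Qed.

End scheme_laws.

(** * Time regularity of the scheme *)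

Section time_regularity.
Context (R : realType) (d : nat) (T : R).
Context (L : 'rV[R]_d -> 'rV[R]_d -> R) (F G : 'rV[R]_d -> P1 R d -> R).
Context (Cb : R) (rho m0 : 'rV[R]_d -> R) (m0s : P1 R d).
Context (N : nat) (dx eps : R) (mu : R -> P1 R d) (Cbf : R).
Hypotheses (dx0 : 0 < dx) (N0 : (0 < N)%N) (T0 : 0 < T).
Hypothesis m0E : forall A, measurable A ->
  m0s A = (\int[lebesgue_rV R d]_(x in A) (m0 x)%:E)%E.
Hypothesis m_flow : forall k, (k <= N)%N ->
  measurable_fun setT (flow T L F G Cb rho N dx eps mu k).
Hypothesis drift_le : forall t x, 0 <= t <= T ->
    enorm (drift T L F G Cb rho N dx eps mu t x) <= Cbf.

Let dt0 : 0 < dt T N. Proof. by rewrite divr_gt0// ltr0n. Qed.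

Let ratio_itv t : 0 <= t <= T ->
  0 <= t / dt T N /\ (Num.truncn (t / dt T N) <= N)%N.
Proof.
move=> /andP[t0 tT]; split; first by rewrite divr_ge0// ltW.
have tN : t / dt T N <= N%:R.
  by rewrite ler_pdivrMr// /dt mulrC divfK// pnatr_eq0 -lt0n.
by have := le_truncn tN; rewrite natrK.
Qed.

Lemma flow_dist k x : (k <= N)%N ->
  enorm (flow T L F G Cb rho N dx eps mu k x - x) <= dt T N * Cbf.
Proof.
move=> kN; rewrite /flow addrC addKr enormN enormZ gtr0_norm// ler_pM2l//.
apply: drift_le; rewrite /tk mulr_ge0 ?ler0n ?(ltW dt0)//=.
by rewrite /dt mulrCA ler_piMr ?(ltW T0)// ler_pdivrMr ?ltr0n// mul1r ler_nat.
Qed.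

(** In units of the time step, one step costs [dt * Cbf + dx * sqrt d], which
    [dx <= c * dt] turns into a multiple of [dt]. *)
Lemma density_laws : exists m : R -> P1 R d,
  (forall t, 0 <= t <= T -> forall A : set 'rV[R]_d, measurable A ->
    m t A = (\int[lebesgue_rV R d]_(x in A)
               (density T L F G Cb rho m0 N dx eps mu t x)%:E)%E) /\
  forall c : R, dx <= c * dt T N ->
  forall t s : R, 0 <= t <= T -> 0 <= s <= T ->
    (d1 (m t) (m s) <= ((Cbf + c * Num.sqrt d%:R) * `|t - s|)%:E)%E.
Proof.
have fK := flow_dist.
have [nu [nu0 nuS]] := scheme_laws_exist m0s dx0 m_flow fK.
have chain j l : (j <= l <= N.+1)%N -> transport (nu j) (nu l)
    ((l%:R - j%:R) * (dt T N * Cbf + dx * Num.sqrt d%:R)).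
  move=> /andP[]; elim: l => [|l IHl].
    rewrite leqn0 => /eqP -> _; rewrite subrr mul0r; exact: transport_refl.
  rewrite leq_eqVlt => /orP[/eqP -> _|jl lN].
    rewrite subrr mul0r; exact: transport_refl.
  have /(transport_scatter dx0 (m_flow lN) (fun x => fK l x lN) (nuS l lN)) :=
    IHl jl (ltnW lN).
  by congr (transport _ _ _); rewrite -natr1; ring.
have /choice[m mE] : forall t, exists S : P1 R d, 0 <= t <= T ->
    forall A, S A = interpolant nu (t / dt T N) A.
  move=> t; have [tT|_] := boolP (0 <= t <= T); last by exists (nu 0).
  have [t0 tN] := ratio_itv tT.
  have /andP[w0 w1] := theta_itv t0.
  have w01 : 0 <= t / dt T N - (Num.truncn (t / dt T N))%:R <= 1 by rewrite w0 ltW.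
  have [S SE] := mixture_P1 (nu (Num.truncn (t / dt T N)))
    (nu (Num.truncn (t / dt T N)).+1) w01.
  by exists S.
exists m; split=> [t tT A mA|c cdt t s].
  have [t0 tN] := ratio_itv tT; have /andP[w0 w1] := theta_itv t0.
  rewrite mE// /density /interpolant.
  set k := Num.truncn _ in tN w0 w1 *; set w := _ - _ in w0 w1 *.
  have D0 j : (j <= N.+1)%N -> forall x, A x ->
      (0 <= (density_node T L F G Cb rho m0 N dx eps mu j x)%:E)%E.
    by move=> jN x _; rewrite lee_fin; exact: (density_node_ge0 dx0 m0E m_flow nu0 nuS).
  have mD j : measurable_fun A (fun x =>
      (density_node T L F G Cb rho m0 N dx eps mu j x)%:E).
    by apply/measurable_EFinP; apply: measurable_funTS; exact: measurable_density_node.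
  have ID := integral_density_node dx0 m0E m_flow nu0 nuS.
  under eq_integral do rewrite EFinD !EFinM.
  have w1' : 0 <= 1 - w by rewrite subr_ge0 ltW.
  rewrite ge0_integralD//; first last.
  - exact: measurable_funeM.
  - by move=> x Ax; rewrite mule_ge0//; exact: D0.
  - exact: measurable_funeM.
  - by move=> x Ax; rewrite mule_ge0//; apply: D0 => //; exact: leqW.
  rewrite !ge0_integralZl//; [|exact: D0|by apply: D0; exact: leqW].
  by rewrite !ID// leqW.
have main t' s' : 0 <= t' <= T -> 0 <= s' <= T -> t' <= s' ->
    transport (m t') (m s') ((s' - t') / dt T N *
      (dt T N * Cbf + dx * Num.sqrt d%:R)).
  move=> tT sT ts; have [t0 tN] := ratio_itv tT; have [s0 sN] := ratio_itv sT.
  have := @transport_interpolant _ _ _ _ _ chain (t' / dt T N) (s' / dt T N) _ sN.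
  rewrite t0 ler_pM2r ?invr_gt0// => /(_ ts).
  rewrite -mulrBl; apply: eq_transport => A mA; by rewrite mE.
have bound t' s' : t' <= s' -> (s' - t') / dt T N *
      (dt T N * Cbf + dx * Num.sqrt d%:R) <= (Cbf + c * Num.sqrt d%:R) * (s' - t').
  move=> ts; rewrite -mulrA [leRHS]mulrC ler_wpM2l ?subr_ge0//.
  rewrite mulrDr mulKf ?lt0r_neq0// lerD2l mulrCA mulrA.
  by rewrite ler_wpM2r ?sqrtr_ge0// ler_pdivrMr.
move=> tT sT; have [ts|/ltW st] := leP t s.
  apply: (le_trans (d1_le_transport (main _ _ tT sT ts))).
  by rewrite lee_fin distrC ger0_norm ?subr_ge0// bound.
apply: (le_trans (d1_le_transport (transport_sym (main _ _ sT tT st)))).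
by rewrite lee_fin ger0_norm ?subr_ge0// bound.
Qed.

End time_regularity.

(** * Measurability of limits of difference quotients *)

Section measurable_limit_at_zero.
Context (R : realType) dX (X : measurableType dX) (q : X -> R -> R).
Hypothesis mq : forall h, h != 0 -> measurable_fun setT (fun z => q z h).
Hypothesis cq : forall z h, h != 0 -> {for h, continuous (q z)}.

Let pball (n : nat) : set R := [set h | h != 0 /\ `|h| < n.+1%:R^-1].

Let cauchy_set : set X := \bigcap_(m in [set: nat]) \bigcup_(n in [set: nat])
  \bigcap_(ab in [set ab : rat * rat | pball n (ratr ab.1) /\ pball n (ratr ab.2)])
    [set z | `|q z (ratr ab.1) - q z (ratr ab.2)| <= m.+1%:R^-1].

Let measurable_cauchy_set : measurable cauchy_set.
Proof.
apply: bigcap_measurable => [|m _]; first by exists 0%N.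
apply: bigcup_measurable => n _.
have -> : \bigcap_(ab in [set ab : rat * rat | pball n (ratr ab.1) /\ pball n (ratr ab.2)])
    [set z | `|q z (ratr ab.1) - q z (ratr ab.2)| <= m.+1%:R^-1] =
  ~` \bigcup_(ab in [set ab : rat * rat | pball n (ratr ab.1) /\ pball n (ratr ab.2)])
    ~` [set z | `|q z (ratr ab.1) - q z (ratr ab.2)| <= m.+1%:R^-1].
  by rewrite setC_bigcup; apply: eq_bigcapr => ab _; rewrite setCK.
apply: measurableC; rewrite bigcup_mkcond.
apply: countable_bigcupT_measurable => // -[a b]; case: ifP => // /set_mem [[a0 _] [b0 _]].
apply: measurableC => /=.
have mf : measurable_fun setT (fun z => `|q z (ratr a) - q z (ratr b)|).
  apply: measurableT_comp => //; apply: measurable_funB; exact: mq.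
have := mf measurableT _ (measurable_itv `]-oo, m.+1%:R^-1]).
by rewrite setTI; congr measurable; apply/seteqP; split=> z /=; rewrite in_itv.
Qed.

Let rat_approx z h (n : nat) (eta : R) : pball n h -> 0 < eta ->
  exists2 a : rat, pball n (ratr a) & `|q z h - q z (ratr a)| < eta.
Proof.
move=> [h0 hn] eta0.
have cidh : (fun x : R => x) x @[x --> h] --> h by exact: cvg_id.
have H1 : \forall x \near h, x != 0 by exact: (cvgr_neq0 _ cidh h0).
have H2 : \forall x \near h, `|x| < n.+1%:R^-1.
  by exact: (cvgr_norm_lt _ cidh _ hn).
have H3 : \forall x \near h, `|q z h - q z x| < eta.
  by have /cvgrPdist_lt := @cq z _ h0; exact.
have : \forall x \near h, [/\ x != 0, `|x| < n.+1%:R^-1 & `|q z h - q z x| < eta].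
  exact: filterS3 H1 H2 H3.
move=> /nbhs_ballP[r /= r0 hr].
have : h - r < h + r by rewrite ltrD2l gtrN.
move=> /rat_in_itvoo[a]; rewrite in_itv/= -ltr_distlC => ha.
by have [] := hr _ ha; exists a.
Qed.

Let cvgE z : cauchy_set z <-> cvg (q z h @[h --> 0^']).
Proof.
split=> [zC|/cvg_ex[l ql] m _].
  apply: cauchy_cvg; apply/cauchy_exP => e e0.
  have [m me] : exists m : nat, m.+1%:R^-1 < e / 3.
    have [m _ mH] := near_infty_natSinv_lt (PosNum (divr_gt0 e0 (ltr0n R 3))).
    by exists m; exact: (mH m (leqnn m)).
  have [n _ nH] := zC m Logic.I.
  have b1 : pball n (n.+2%:R^-1).
    by split; [rewrite invr_eq0 pnatr_eq0|rewrite gtr0_norm// ltf_pV2 ?posrE// ltr_nat].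
  exists (q z n.+2%:R^-1).
  have e3 : 0 < e / 3 by rewrite divr_gt0.
  have [a ap aq] := rat_approx z b1 e3.
  apply/nbhs_ballP; exists n.+1%:R^-1 => //= h; rewrite -ball_normE /= sub0r normrN => hn h0.
  have [b bp bq] := rat_approx z (conj h0 hn) e3.
  have ab := nH (a, b) (conj ap bp); rewrite /= in ab.
  change (`|q z n.+2%:R^-1 - q z h| < e).
  rewrite (_ : _ - _ = (q z n.+2%:R^-1 - q z (ratr a)) + (q z (ratr a) - q z (ratr b))
    - (q z h - q z (ratr b))); last by ring.
  rewrite (le_lt_trans (ler_normB _ _))//.
  have := ler_normD (q z n.+2%:R^-1 - q z (ratr a)) (q z (ratr a) - q z (ratr b)).
  move: (le_lt_trans ab me) aq bq; clear; lra.
have : \forall h \near 0^', `|l - q z h| < m.+1%:R^-1 / 2.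
  by have /cvgrPdist_lt := ql; apply; rewrite divr_gt0.
move=> /nbhs_ballP[r /= r0 hr].
have [n nr] : exists n : nat, n.+1%:R^-1 < r.
  by have [n _ /(_ n)/(_ (leqnn n))] := near_infty_natSinv_lt (PosNum r0); exists n.
exists n => // -[a b] /= [[a0 an] [b0 bn]].
have H h : h != 0 -> `|h| < n.+1%:R^-1 -> `|l - q z h| < m.+1%:R^-1 / 2.
  by move=> h0 hn; apply: hr => //; rewrite -ball_normE /= sub0r normrN (lt_trans hn).
have := H _ a0 an; have := H _ b0 bn.
have := ler_normB (l - q z (ratr b)) (l - q z (ratr a)).
rewrite (_ : l - q z (ratr b) - _ = q z (ratr a) - q z (ratr b)); last by ring.
by move: (m.+1%:R^-1 : R) => e; clear; lra.
Qed.

(** By continuity in [h], the limit exists exactly at the points where the Cauchy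
    criterion holds along rational [h], and this is a measurable condition. There
    the limit can be taken along [1 / (n + 1)]; elsewhere [lim] is a constant. *)
Lemma measurable_lim_at0 : measurable_fun setT (fun z => lim (q z h @[h --> 0^'])).
Proof.
rewrite -(setUv cauchy_set); apply/measurable_funU => //; first exact: measurableC.
split.
  apply: (@measurable_fun_cvg _ _ _ _ (fun n z => q z n.+1%:R^-1)) => [n|z /cvgE zC].
    by apply: measurable_funTS; apply: mq; rewrite invr_eq0 pnatr_eq0.
  apply: (cvg_comp _ _ _ zC) => A; rewrite /= => /nbhs_ballP[r /= r0 rA].
  have [n _ nH] := near_infty_natSinv_lt (PosNum r0).
  exists n => // k /= nk; apply: rA; last by rewrite invr_eq0 pnatr_eq0.
  by rewrite -ball_normE /= sub0r normrN gtr0_norm ?invr_gt0//; exact: nH.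
apply: (@eq_measurable_fun _ _ _ _ _ (fun=> point)) => [z|]; last exact: measurable_cst.
rewrite inE => zC; rewrite dvgP// => zC'.
by apply: zC; apply/cvgE.
Qed.

End measurable_limit_at_zero.

(** * Measurability of gradients *)

Section measurable_derivatives.
Context (R : realType) (d : nat).
Implicit Types (f : 'rV[R]_d -> R) (v : 'rV[R]_d).

Lemma continuous_measurable_rV f : continuous f ->
  measurable_fun setT (f : 'rV[R]_d -> measurableTypeR R).
Proof.
move=> cf.
apply: (@measurability _ _ _ (measurableTypeR R) _ _ (@RGenOpens.G R)).
  exact: RGenOpens.measurableE.
move=> _ [_ [a [b ->]] <-]; rewrite setTI.
by apply: open_measurable_rV; apply: open_comp => //; exact: interval_open.
Qed.

Lemma continuous_along_line f x v h : continuous f ->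
  {for h, continuous (fun h : R => f (x + h *: v))}.
Proof.
move=> cf; apply: (@continuous_comp _ _ _ (fun h : R => x + h *: v) f); last exact: cf.
apply: continuousD; first exact: cst_continuous.
by apply: continuousZr_tmp; exact: cvg_id.
Qed.

Lemma derive_quotientE f x v :
  'D_v f x = lim ((fun h : R => h^-1 * (f (x + h *: v) - f x)) @ 0^').
Proof.
apply: (congr1 (fun g : R -> R => lim (g @ 0^'))); apply/funext => h.
by rewrite /= [h *: v + x]addrC.
Qed.

Lemma measurable_derive f v : continuous f ->
  measurable_fun setT (fun x => 'D_v f x).
Proof.
move=> cf.
rewrite (_ : (fun x => _) =
    (fun x => lim ((fun h : R => h^-1 * (f (x + h *: v) - f x)) @ 0^'))); last first.
  by apply/funext => x; rewrite derive_quotientE.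
have H := (@measurable_lim_at0 R _ _ (fun (x : 'rV[R]_d) h => h^-1 * (f (x + h *: v) - f x))).
apply: H => [h h0|x h h0].
  apply: measurable_funM => //; apply: measurable_funB; last exact: continuous_measurable_rV.
  apply: continuous_measurable_rV.
  have c : continuous (fun y : 'rV[R]_d => y + h *: v).
    move=> y; apply: (@continuousD _ _ _ id (cst (h *: v))); first exact: cvg_id.
    exact: cst_continuous.
  by move=> x; exact: (continuous_comp (c x) (cf _)).
apply: continuousM; first exact: inv_continuous.
by apply: continuousB; [exact: continuous_along_line|exact: cst_continuous].
Qed.

Lemma measurable_grad f : continuous f -> measurable_fun setT (grad f).
Proof.
move=> cf; apply: measurable_fun_rV => i.
rewrite (_ : (fun x => _) = (fun x => 'D_(delta_mx 0 i) f x)).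
  exact: measurable_derive.
by apply/funext => x; rewrite mxE.
Qed.

End measurable_derivatives.

(** * Regularity of the multilinear interpolation *)

Section interpolation.
Context (R : realType) (d : nat) (dx : R).
Hypothesis dx0 : 0 < dx.
Implicit Types (i : 'rV[int]_d) (x y : 'rV[R]_d) (phi : 'rV[int]_d -> R).

Lemma coord_le_norm x (l : 'I_d) : `|x 0 l| <= `|x|.
Proof. by rewrite [leRHS]mx_normrE; apply: (bigmax_sup (ord0, l)). Qed.

(** The nodes whose hat function may be nonzero at distance at most [dx] of [x]: in
    each direction there are at most four. *)
Definition stencil x (k : {ffun 'I_d -> 'I_4}) : 'rV[int]_d :=
  \row_l (Num.floor (x 0 l / dx) + (k l : nat)%:Z - 1).

Lemma stencil_inj x : injective (stencil x).
Proof.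
move=> k k' /rowP kk'; apply/ffunP => l; apply/val_inj.
by have := kk' l; rewrite !mxE => /addIr/addrI[].
Qed.

Lemma hat_itv (s : R) : 0 <= Num.max 0 (1 - `|s|) <= 1.
Proof. by rewrite le_max lexx/= ge_max ler01 lerBlDr lerDl normr_ge0. Qed.

Lemma beta1_itv i x : 0 <= beta1 dx i x <= 1.
Proof.
apply/andP; split.
  by apply: prodr_ge0 => l _; have /andP[] := hat_itv (x 0 l / dx - (i 0 l)%:~R).
by apply: Num.Theory.prodr_ile1 => l _; exact: hat_itv.
Qed.

Lemma beta1_support i x : beta1 dx i x != 0 ->
  forall l, `|x 0 l / dx - (i 0 l)%:~R| < 1.
Proof.
move=> /prodf_neq0 bi l; rewrite ltNge; apply: contra (bi l isT) => h.
by rewrite max_l// subr_le0.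
Qed.

(** Near a point the interpolation is a sum over a fixed finite set of nodes, with
    a number of terms that does not depend on the point. This gives uniform bounds. *)
Lemma interp1_stencil phi x y : `|x - y| <= dx ->
  interp1 dx phi y =
  \sum_(k : {ffun 'I_d -> 'I_4}) phi (stencil x k) * beta1 dx (stencil x k) y.
Proof.
move=> xy; rewrite /interp1.
rewrite (fsbigE [seq stencil x k | k <- index_enum {ffun 'I_d -> 'I_4}])//.
- by rewrite big_map; apply: eq_bigl => k; rewrite in_setT.
- by rewrite map_inj_uniq ?index_enum_uniq//; exact: stencil_inj.
move=> i _ ix; apply/eqP; apply: contraNT ix; rewrite mulf_eq0 negb_or => /andP[_ bi].
have {}bi := beta1_support bi.
have H l : {k : 'I_4 | i 0 l = Num.floor (x 0 l / dx) + (k : nat)%:Z - 1}.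
  have /andP[c0 c1] := floor_itv (x 0 l / dx).
  set c := Num.floor _ in c0 c1 *.
  have xyl : `|x 0 l / dx - y 0 l / dx| <= 1.
    rewrite -mulrBl normrM [`|dx^-1|]gtr0_norm ?invr_gt0// ler_pdivrMr// mul1r.
    by rewrite (le_trans _ xy)// -[leRHS]/(`|x - y|) (le_trans _ (coord_le_norm _ l))// !mxE.
  have := bi l; rewrite ltr_norml => /andP[b0 b1].
  move: xyl; rewrite ler_norml => /andP[a0 a1].
  rewrite intrD in c1.
  have i0 : c - 2 < i 0 l by rewrite -(ltr_int R) intrB; lra.
  have i1 : i 0 l < c + 3 by rewrite -(ltr_int R) intrD; lra.
  have nE : i 0 l = c + (absz (i 0 l - c + 1)%R)%:Z - 1 by lia.
  have n4 : (absz (i 0 l - c + 1)%R < 4)%N by lia.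
  by exists (Ordinal n4).
apply/mapP; exists [ffun l => sval (H l)]; first by rewrite mem_index_enum.
by apply/rowP => l; rewrite mxE ffunE; case: (H l).
Qed.

Lemma interp1_bounded phi (B : R) x : (forall i, `|phi i| <= B) ->
  `|interp1 dx phi x| <= #|{: {ffun 'I_d -> 'I_4}}|%:R * B.
Proof.
move=> phiB; rewrite (@interp1_stencil _ x) ?subrr ?normr0 ?(ltW dx0)//.
rewrite (le_trans (ler_norm_sum _ _ _))// mulr_natl -sumr_const; apply: ler_sum => k _.
rewrite normrM; have /andP[b0 b1] := beta1_itv (stencil x k) x.
by rewrite (ger0_norm b0) (le_trans _ (phiB (stencil x k)))// ler_piMr.
Qed.

Lemma hat_lipschitz (s t : R) :
  `|Num.max 0 (1 - `|s|) - Num.max 0 (1 - `|t|)| <= `|s - t|.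
Proof.
have st := ler_dist_dist s t; rewrite ler_norml in st.
move: st; rewrite ler_norml /Num.max; case: ifPn; case: ifPn; lra.
Qed.

Lemma prod_lipschitz (I : Type) (r : seq I) (f g : I -> R) :
  (forall k, 0 <= f k <= 1) -> (forall k, 0 <= g k <= 1) ->
  `|\prod_(k <- r) f k - \prod_(k <- r) g k| <= \sum_(k <- r) `|f k - g k|.
Proof.
move=> f01 g01; elim: r => [|k r IHr]; first by rewrite !big_nil subrr normr0.
rewrite !big_cons.
set A := \prod_(j <- r) f j in IHr *; set B := \prod_(j <- r) g j in IHr *.
rewrite (_ : _ - _ = (f k - g k) * A + g k * (A - B)); last by ring.
rewrite (le_trans (ler_normD _ _))// !normrM lerD//.
  rewrite ler_piMr// ger0_norm; last by apply: prodr_ge0 => j _; case/andP: (f01 j).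
  by apply: Num.Theory.prodr_ile1 => j _; exact: f01.
rewrite (le_trans _ IHr)// ler_piMl//; have /andP[g0 g1] := g01 k.
by rewrite ger0_norm.
Qed.

Lemma beta1_lipschitz i x y :
  `|beta1 dx i x - beta1 dx i y| <= d%:R / dx * `|x - y|.
Proof.
rewrite /beta1 (le_trans (prod_lipschitz _ _ _))//; [by move=> l; exact: hat_itv|
  by move=> l; exact: hat_itv|].
rewrite (@le_trans _ _ (\sum_(l < d) (`|x - y| / dx)))//; last first.
  by rewrite sumr_const card_ord -mulrA [dx^-1 * _]mulrC mulr_natl.
apply: ler_sum => l _; rewrite (le_trans (hat_lipschitz _ _))//.
rewrite (_ : _ - _ = (x - y) 0 l / dx); last by rewrite !mxE; ring.
rewrite normrM [`|dx^-1|]gtr0_norm ?invr_gt0// ler_pM2r ?invr_gt0//.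
exact: coord_le_norm.
Qed.

Lemma interp1_lipschitz phi (B : R) x y : (forall i, `|phi i| <= B) -> `|x - y| <= dx ->
  `|interp1 dx phi x - interp1 dx phi y| <=
  #|{: {ffun 'I_d -> 'I_4}}|%:R * (B * (d%:R / dx)) * `|x - y|.
Proof.
move=> phiB xy; rewrite (interp1_stencil _ xy).
rewrite (@interp1_stencil _ x) ?subrr ?normr0 ?(ltW dx0)//.
rewrite -sumrB (le_trans (ler_norm_sum _ _ _))// -mulrA mulr_natl -sumr_const.
apply: ler_sum => k _; rewrite -mulrBr normrM -mulrA ler_pM//.
exact: beta1_lipschitz.
Qed.

End interpolation.

(** * Regularity of the mollified value function *)

Section mollification.
Context (R : realType) (d : nat).
Implicit Types (r V : 'rV[R]_d -> R).

Lemma lipschitz_continuous_rV (f : 'rV[R]_d -> R) (K del : R) : 0 < del -> 0 <= K ->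
  (forall x y : 'rV[R]_d, `|x - y| <= del -> `|f x - f y| <= K * `|x - y|) ->
  continuous f.
Proof.
move=> del0 K0 fK x; apply/(@cvgrPdist_le _ _ _ _ (nbhs_filter x)) => e e0.
apply/nbhs_ballP.
have K1 : 0 < K + 1 by rewrite ltr_wpDl.
exists (Num.min del (e / (K + 1))) => /=.
  by rewrite lt_min del0 divr_gt0.
move=> y; rewrite -ball_normE /= lt_min => /andP[yd].
rewrite ltr_pdivlMr// => ye; rewrite (le_trans (fK _ _ (ltW yd)))//.
rewrite (le_trans _ (ltW ye))// mulrC ler_wpM2l//.
by rewrite lerDl.
Qed.

(** The local Lipschitz bound on [V] passes to the convolution, multiplied by the
    integral of [r]. *)
Lemma convolution_continuous r V (B K del : R) : 0 < del -> 0 <= K ->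
  (lebesgue_rV R d).-integrable setT (EFin \o r) -> (forall y, 0 <= r y) ->
  (forall x, `|V x| <= B) ->
  (forall x y : 'rV[R]_d, `|x - y| <= del -> `|V x - V y| <= K * `|x - y|) ->
  continuous (fun x : 'rV[R]_d => \int[lebesgue_rV R d]_y (r y * V (x - y))).
Proof.
move=> del0 K0 ir r0 VB VK.
have cV := lipschitz_continuous_rV del0 K0 VK.
pose C := \int[lebesgue_rV R d]_y r y.
have C0 : 0 <= C by apply: Rintegral_ge0.
have mr : measurable_fun setT r by apply/measurable_EFinP; exact: measurable_int ir.
have mVx (x : 'rV[R]_d) : measurable_fun setT (fun y : 'rV[R]_d => V (x - y)).
  apply: (measurableT_comp (continuous_measurable_rV cV)).
  apply: measurable_fun_rV => i.
  rewrite (_ : (fun y => _) = (fun y : 'rV[R]_d => x 0 i - y 0 i)).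
    by apply: measurable_funB => //; exact: measurable_coord.
  by apply/funext => y; rewrite !mxE.
have iV (x : 'rV[R]_d) : (lebesgue_rV R d).-integrable setT
    (fun y : 'rV[R]_d => (r y * V (x - y))%:E).
  apply: (@le_integrable _ _ _ _ _ _ _ (fun y => B%:E * (r y)%:E)%E) => //.
  - by apply/measurable_EFinP; exact: measurable_funM.
  - move=> y _; rewrite /= lee_fin normrM normrM mulrC ler_wpM2r//.
    by rewrite (le_trans (VB _))// ler_norm.
  - exact: integrableZl.
apply: (@lipschitz_continuous_rV _ (K * C) del) => //; first by rewrite mulr_ge0.
move=> x y xy; rewrite -RintegralB//; [|exact: (iV x)|exact: (iV y)].
have iB : (lebesgue_rV R d).-integrable setT
    (EFin \o (fun z => r z * V (x - z) - r z * V (y - z))).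
  exact: (integrableB measurableT (iV x) (iV y)).
rewrite (le_trans (le_normr_Rintegral _ iB))//.
have iC : (lebesgue_rV R d).-integrable setT (EFin \o (fun z => K * `|x - y| * r z)).
  exact: (integrableZl measurableT _ ir).
rewrite (_ : K * C * `|x - y| = \int[lebesgue_rV R d]_z (K * `|x - y| * r z)); last first.
  by rewrite RintegralZl// mulrAC.
apply: le_Rintegral => //; first exact: integrable_norm.
move=> z _; rewrite -mulrBr normrM (ger0_norm (r0 z)) mulrC ler_wpM2r//.
have := VK (x - z) (y - z).
by rewrite (_ : x - z - (y - z) = x - y) => [/(_ xy)//|]; rewrite opprB addrA subrK.
Qed.

Lemma integrable_rescaled r (eps : R) : 0 < eps ->
  (lebesgue_rV R d).-integrable setT (EFin \o r) ->
  (lebesgue_rV R d).-integrable setT (EFin \o rho_eps r eps).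
Proof.
move=> e0 ir; have mphi := @measurable_affine_rV R d eps^-1 0.
have e0' : 0 < eps^-1 by rewrite invr_gt0.
have mr := measurable_int _ ir.
have mh : measurable_fun setT (abse \o (EFin \o r)) by exact: measurableT_comp.
have c0 : 0 <= (eps^-1) ^- d by rewrite invr_ge0 exprn_ge0// ltW.
have rE : EFin \o rho_eps r eps =
    (fun x => (eps ^- d)%:E * (r (eps^-1 *: x + 0)%R)%:E)%E.
  by apply/funext => x; rewrite /= addr0 -EFinM.
rewrite rE; apply: integrableZl => //; apply/integrableP; split.
  exact: (measurableT_comp mr mphi).
have := ge0_integral_pushforward mphi (lebesgue_rV R d) measurableT mh (fun x _ => abse_ge0 _).
rewrite preimage_setT => <-.
rewrite (@eq_measure_integral _ _ _ _ (mscale (NngNum c0) (lebesgue_rV R d))); last first.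
  by move=> A mA _; rewrite /mscale/= /pushforward lebesgue_rV_affine.
rewrite ge0_integral_mscale//= lte_mul_pinfty//.
by have /integrableP[] := ir.
Qed.

End mollification.

Section value_bounds.
Context (R : realType) (d : nat) (T : R).
Context (L : 'rV[R]_d -> 'rV[R]_d -> R) (F G : 'rV[R]_d -> P1 R d -> R).
Context (Cb dx : R) (N : nat) (mu : R -> P1 R d).
Hypotheses (dx0 : 0 < dx) (Cb0 : 0 < Cb) (T0 : 0 < T) (N0 : (0 < N)%N).
Hypotheses (hL : lagrangian L) (hF : coupling_cost F) (hG : coupling_cost G).

(** The infimum is bounded from below because [L] is, and from above by its value
    at [a = 0]. *)
Lemma value_back_bounded n : exists B, forall i,
  `|value_back T L F G Cb N dx mu n i| <= B.
Proof.
have dt0 : 0 < dt T N by rewrite divr_gt0// ltr0n.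
have [_ [CF1 [CF2 [CF3 [_ hF']]]]] := hF.
have [_ [CG1 [CG2 [CG3 [_ hG']]]]] := hG.
have FB x nu : `|F x nu| <= CF1 by have [] := hF' x x nu.
have GB x nu : `|G x nu| <= CG1 by have [] := hG' x x nu.
have [_ [m Lm] [C1 [C2 [C3 [C4 [C5 [_ hL']]]]]]] := hL.
have L0 x : L x 0 <= C2.
  by have [+ _ _ _] := hL' x 0 0 0; rewrite enorm0 expr0n/= mulr0 add0r.
elim: n => [|n [B vB]]; first by exists CG1 => i; exact: GB.
have [S SE] : exists S, forall x, `|interp1 dx (value_back T L F G Cb N dx mu n) x| <= S.
  by exists (#|{: {ffun 'I_d -> 'I_4}}|%:R * B) => x; exact: interp1_bounded.
exists (dt T N * `|m| + dt T N * `|C2| + S + dt T N * CF1) => i /=.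
set E := [set _ | _ in _].
have SS x := ler_normlP _ _ (SE x).
have Elb : lbound E (dt T N * m - S).
  move=> _ [a _ <-]; rewrite lerD//; first by rewrite ler_wpM2l// ltW.
  by have [+ _] := SS (node dx i - dt T N *: a); rewrite lerNl.
have E0 : E (dt T N * L (node dx i) 0 + interp1 dx (value_back T L F G Cb N dx mu n)
    (node dx i - dt T N *: 0)).
  by exists 0 => //=; rewrite enorm0 ltW.
have lo : dt T N * m - S <= inf E by apply: lb_le_inf => //; eexists; exact: E0.
have hi : inf E <= dt T N * C2 + S.
  apply: (@le_trans _ _ _ _ _ (ge_inf _ E0)); first by exists (dt T N * m - S).
  rewrite lerD//; first by rewrite ler_wpM2l// ltW.
  by have [] := SS (node dx i - dt T N *: 0).
have S0 : 0 <= S by rewrite (le_trans _ (SE 0)).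
have dm : dt T N * - `|m| <= dt T N * m.
  by rewrite ler_wpM2l ?(ltW dt0)// lerNl; have := ler_norm (- m); rewrite normrN.
have dC : dt T N * C2 <= dt T N * `|C2| by rewrite ler_wpM2l ?(ltW dt0)// ler_norm.
rewrite (le_trans (ler_normD _ _))// lerD//; last first.
  by rewrite normrM (gtr0_norm dt0) ler_wpM2l ?(ltW dt0).
have d1 : 0 <= dt T N * `|m| by rewrite mulr_ge0// ltW.
have d2 : 0 <= dt T N * `|C2| by rewrite mulr_ge0// ltW.
rewrite mulrN in dm.
rewrite ler_norml; apply/andP; split; lra.
Qed.

End value_bounds.

(** * Convexity *)

Section strong_convexity.
Context (R : realType) (d : nat).
Implicit Types (f : 'rV[R]_d -> R) (a b : 'rV[R]_d).

Lemma derive_grad f a v : differentiable f a -> 'D_v f a = dotrv v (grad f a).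
Proof.
move=> df; rewrite deriveE// {1}(row_sum_delta v) linear_sum/= /dotrv.
by apply: eq_bigr => j _; rewrite linearZ/= !mxE /partial deriveE.
Qed.

Lemma is_derive_line f a (s : R) : differentiable f (s *: a) ->
  is_derive s 1 (fun s => f (s *: a)) (dotrv a (grad f (s *: a))).
Proof.
move=> df; have := diff_derivable (v := a) df.
have E : (fun h : R => h^-1 *: (((fun s => f (s *: a)) \o shift s) (h *: 1) - f (s *: a)))
  = (fun h : R => h^-1 *: ((f \o shift (s *: a)) (h *: a) - f (s *: a))).
  by apply/funext => h /=; rewrite -scalerDl [h *: 1]mulr1.
split; first by rewrite /derivable E.
by rewrite -derive_grad// /derive E.
Qed.

Lemma is_derive_line2 f a (s : R) : (forall j, differentiable (partial j f) (s *: a)) ->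
  is_derive s 1 (fun s => dotrv a (grad f (s *: a)))
    (dotrv (a *m hess f (s *: a)) a).
Proof.
move=> df.
have H j := @is_derive_line (partial j f) a s (df j).
have Hs := is_derive_sum (fun j => is_deriveZ (a 0 j) (H j)).
rewrite (_ : (fun s => _) = \sum_(j < d) (a 0 j \*: (fun s : R => partial j f (s *: a)))).
  apply: is_derive_eq; rewrite /dotrv; apply: eq_bigr => j _.
  rewrite mxE /= mulrC; congr (_ * _); apply: eq_bigr => i _.
  by rewrite !mxE.
apply/funext => t; rewrite fct_sumE /dotrv; apply: eq_bigr => j _.
by rewrite mxE.
Qed.

Lemma nondecreasing_of_derive (g dg : R -> R) (b : R) : 0 <= b ->
  (forall s : R, is_derive s (1 : R) g (dg s)) -> (forall s, 0 <= s <= b -> 0 <= dg s) ->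
  g 0 <= g b.
Proof.
rewrite le_eqVlt => /orP[/eqP <-//|b0] gdg dg0.
have gc : {within `[0, b], continuous g}.
  apply: continuous_subspaceT => s; apply: differentiable_continuous.
  by apply/derivable1_diffP; have [] := gdg s.
have [c] := MVT b0 (fun x _ => gdg x) gc.
rewrite in_itv/= => /andP[c0 cb] gE.
by rewrite -subr_ge0 gE mulr_ge0 ?subr_ge0 ?(ltW b0)// dg0// !ltW.
Qed.

(** Along the segment from 0 to [a], the difference between both sides has a
    nonnegative second derivative, and vanishes with its first derivative at 0. *)
Lemma strong_convexity_lower_bound f (C : R) a :
  (forall x, differentiable f x) -> (forall j x, differentiable (partial j f) x) ->
  (forall x b, C * enorm b ^+ 2 <= dotrv (b *m hess f x) b) ->
  f 0 + dotrv a (grad f 0) + C / 2 * enorm a ^+ 2 <= f a.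
Proof.
move=> df d2f hC.
pose g (s : R) := f (s *: a) - dotrv a (grad f 0) * s - C / 2 * enorm a ^+ 2 * s ^+ 2.
pose g' (s : R) := dotrv a (grad f (s *: a)) - dotrv a (grad f 0) - C * enorm a ^+ 2 * s.
pose g'' (s : R) := dotrv (a *m hess f (s *: a)) a - C * enorm a ^+ 2.
have D1 (s : R) : is_derive s 1 g (g' s).
  have H := is_derive_line (df (s *: a)).
  rewrite /g; apply: is_derive_eq.
  by rewrite /g' /GRing.scale/=; field.
have D2 (s : R) : is_derive s 1 g' (g'' s).
  have H := is_derive_line2 (fun j => d2f j (s *: a)).
  rewrite /g'; apply: is_derive_eq.
  by rewrite /g'' /GRing.scale/=; ring.
have g'0 : g' 0 = 0 by rewrite /g' scale0r subrr mulr0 subr0.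
have g'ge s : 0 <= s -> 0 <= g' s.
  move=> s0; rewrite -g'0; apply: (nondecreasing_of_derive s0 D2) => t _.
  by rewrite subr_ge0.
have := nondecreasing_of_derive ler01 D1 (fun s => fun h => g'ge s (andP h).1).
rewrite /g scale0r scale1r !mulr0 !subr0 !mulr1 expr1n expr0n /= mulr0 subr0 mulr1.
lra.
Qed.

End strong_convexity.

(** The values at [x - 1] and [x + 1] bound the slopes of the chords from [x]. *)
Lemma convex_continuous_real (R : realType) (g : R -> R) :
  (forall x y t, 0 <= t <= 1 -> g ((1 - t) * x + t * y) <= (1 - t) * g x + t * g y) ->
  continuous g.
Proof.
move=> cg x.
pose K := `|g (x + 1) - g x| + `|g (x - 1) - g x|.
have K0 : 0 <= K by rewrite addr_ge0.
have Kg h : `|h| <= 1 -> `|g (x + h) - g x| <= K * `|h|.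
  have up s e : (e = 1 \/ e = -1) -> 0 <= s <= 1 -> g (x + s * e) - g x <= K * s.
    move=> ee /andP[s0 s1]; have := cg x (x + e) s; rewrite s0 s1 => /(_ isT).
    rewrite (_ : (1 - s) * x + s * (x + e) = x + s * e); last by ring.
    have le : g (x + e) - g x <= K.
      rewrite (le_trans (ler_norm _))// /K.
      by case: ee => ->; [rewrite lerDl|rewrite lerDr].
    have := ler_wpM2r s0 le; lra.
  have dn s e : (e = 1 \/ e = -1) -> 0 <= s <= 1 -> g x - g (x + s * e) <= K * s.
    move=> ee /andP[s0 s1].
    have s1' : 0 < 1 + s by rewrite ltr_wpDr.
    have t01 : 0 <= s / (1 + s) <= 1.
      by rewrite divr_ge0 ?(ltW s1')//= ler_pdivrMr// mul1r lerDr.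
    (* [x] lies between [x + s * e] and [x - e] *)
    have := cg (x + s * e) (x - e) (s / (1 + s)) t01.
    have -> : (1 - s / (1 + s)) * (x + s * e) + s / (1 + s) * (x - e) = x.
      by field; exact: lt0r_neq0.
    have -> : (1 - s / (1 + s)) * g (x + s * e) + s / (1 + s) * g (x - e) =
       (g (x + s * e) + s * g (x - e)) / (1 + s) by field; exact: lt0r_neq0.
    rewrite ler_pdivlMr// => H.
    have le : g (x - e) - g x <= K.
      rewrite (le_trans (ler_norm _))// /K.
      by case: ee => ->; [rewrite lerDr|rewrite opprK lerDl].
    have := ler_wpM2r s0 le; lra.
  have [h0|h0] := leP 0 h => h1.
    rewrite (ger0_norm h0) in h1 *.
    have h01 : 0 <= h <= 1 by rewrite h0.
    have := up h 1 (or_introl erefl) h01; have := dn h 1 (or_introl erefl) h01.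
    rewrite mulr1 ler_norml; lra.
  rewrite (ltr0_norm h0) in h1 *.
  have h01 : 0 <= - h <= 1 by rewrite h1 oppr_ge0 ltW.
  have := up (- h) (- 1) (or_intror erefl) h01; have := dn (- h) (- 1) (or_intror erefl) h01.
  rewrite mulrNN mulr1 ler_norml; lra.
apply/cvgrPdist_le => e e0; apply/nbhs_ballP.
have K1 : 0 < K + 1 by rewrite ltr_wpDl.
exists (Num.min 1 (e / (K + 1))) => /=; first by rewrite lt_min ltr01 divr_gt0.
move=> y yb; have {}yb : `|x - y| < Num.min 1 (e / (K + 1)) by exact: yb.
move: yb; rewrite lt_min => /andP[y1].
rewrite ltr_pdivlMr// => ye.
have := Kg (y - x); rewrite (_ : x + (y - x) = y); last by ring.
rewrite (distrC y x) (distrC (g y)) => /(_ (ltW y1)) H.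
rewrite (le_trans H)// (le_trans _ (ltW ye))// mulrC ler_wpM2l//.
by rewrite lerDl.
Qed.

(** * Measurability of the gradient of the Hamiltonian *)

Section hamiltonian.
Context (R : realType) (d : nat) (L : 'rV[R]_d -> 'rV[R]_d -> R).
Hypothesis hL : lagrangian L.
Implicit Types (x a b p v : 'rV[R]_d).

Let Lu (z : 'rV[R]_d * 'rV[R]_d) := L z.1 z.2.

Let differentiable_slice (g : 'rV[R]_d * 'rV[R]_d -> R) x a :
  (forall z, differentiable g z) -> differentiable (fun a => g (x, a)) a.
Proof.
move=> dg; apply: (@differentiable_comp _ _ _ _ (fun a => (x, a)) g); last exact: dg.
by apply: differentiable_pair.
Qed.

(** The difference quotients coincide, hence so do their limits. *)
Lemma partial_sliceE x j a :
  partial j (L x) a = 'D_((0, delta_mx 0 j) : 'rV[R]_d * 'rV[R]_d) Lu (x, a).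
Proof.
apply: (congr1 (fun g : R -> R => lim (g @ 0^'))); apply/funext => h.
by rewrite /= /Lu /= scaler0 add0r.
Qed.

Lemma differentiable_lagrangian x a : differentiable (L x) a.
Proof.
have [[dL _] _ _] := hL; exact: (differentiable_slice x a dL).
Qed.

Lemma differentiable_partial_lagrangian x j a : differentiable (partial j (L x)) a.
Proof.
have [[_ d2L] _ _] := hL.
rewrite (_ : partial j (L x) = fun a =>
    'D_((0, delta_mx 0 j) : 'rV[R]_d * 'rV[R]_d) Lu (x, a)).
  exact: (differentiable_slice x a (d2L _).1).
by apply/funext => b; exact: partial_sliceE.
Qed.

Lemma continuous_lagrangian1 a : continuous (L^~ a).
Proof.
have [[dL _] _ _] := hL; move=> x.
have := differentiable_continuous (dL (x, a)).
apply: (@continuous_comp _ _ _ (fun x => (x, a)) Lu).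
by apply: differentiable_continuous; apply: differentiable_pair.
Qed.

Definition legendre_set x p := [set dotrv a p - L x a | a in [set: 'rV[R]_d]].

(** By strong convexity [L x] grows quadratically, faster than any linear function,
    so that the supremum defining the Hamiltonian is finite. *)
Lemma legendre_bounded x p : exists M, forall a, dotrv a p - L x a <= M.
Proof.
have [_ _ [C1 [C2 [C3 [C4 [C5 [[_ _ _ C40 _] hL']]]]]]] := hL.
(* the maximum over [A] of [A * Z - C4 / 2 * A ^+ 2] is [Z ^+ 2 / (2 * C4)] *)
exists (enorm (p - grad (L x) 0) ^+ 2 / (2 * C4) - L x 0) => a.
have := strong_convexity_lower_bound a (differentiable_lagrangian x)
  (differentiable_partial_lagrangian x)
  (fun y b => let: And4 _ _ h _ := hL' x y b 0 in h).
set q := grad (L x) 0; set Z := enorm (p - q); set A := enorm a => H.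
have : dotrv a (p - q) <= A * Z by exact: dotrv_le_enorm.
have -> : dotrv a (p - q) = dotrv a p - dotrv a q.
  by rewrite /dotrv -sumrB; apply: eq_bigr => i _; rewrite !mxE mulrBr.
have : 0 <= (Z - C4 * A) ^+ 2 / (2 * C4) by rewrite divr_ge0 ?sqr_ge0// mulr_ge0// ltW.
have -> : (Z - C4 * A) ^+ 2 / (2 * C4) = Z ^+ 2 / (2 * C4) - A * Z + C4 / 2 * A ^+ 2.
  by field; exact: lt0r_neq0.
lra.
Qed.

Lemma legendre_has_sup x p : has_sup (legendre_set x p).
Proof.
split; first by exists (dotrv 0 p - L x 0); exists 0.
by have [M HM] := legendre_bounded x p; exists M => _ [a _ <-].
Qed.

Lemma hamiltonian_ge x p a : dotrv a p - L x a <= hamiltonian L x p.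
Proof. by apply: sup_upper_bound; [exact: legendre_has_sup|exists a]. Qed.

Lemma hamiltonian_le x p M : (forall a, dotrv a p - L x a <= M) ->
  hamiltonian L x p <= M.
Proof.
move=> aM; apply: ge_sup; first by have [] := legendre_has_sup x p.
by move=> _ [a _ <-].
Qed.

(** A finite supremum of affine functions of [p] is convex. *)
Lemma hamiltonian_line_continuous x p v :
  continuous (fun h : R => hamiltonian L x (p + h *: v)).
Proof.
apply: convex_continuous_real => s t w /andP[w0 w1]; apply: hamiltonian_le => a.
have := ler_wpM2l w0 (hamiltonian_ge x (p + t *: v) a).
have w1' : 0 <= 1 - w by rewrite subr_ge0.
have := ler_wpM2l w1' (hamiltonian_ge x (p + s *: v) a).
have E (h : R) : dotrv a (p + h *: v) = dotrv a p + h * dotrv a v.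
  by rewrite /dotrv mulr_sumr -big_split/=; apply: eq_bigr => i _; rewrite !mxE; ring.
rewrite !E; lra.
Qed.

Let rat_vec (n : nat) : 'rV[R]_d :=
  if @unpickle 'rV[rat]_d n is Some q then map_mx ratr q else 0.

(** By continuity of [L] in the control, rational controls suffice in the supremum;
    this makes the Hamiltonian a countable supremum of measurable functions. *)
Lemma hamiltonian_sups x p :
  hamiltonian L x p = sups (fun n => dotrv (rat_vec n) p - L x (rat_vec n)) 0.
Proof.
pose u n := dotrv (rat_vec n) p - L x (rat_vec n); rewrite -/u.
have uM : has_ubound (range u).
  by have [M HM] := legendre_bounded x p; exists M => _ [n _ <-]; exact: HM.
rewrite /sups /= (_ : sdrop u 0 = range u); last first.
  by apply/seteqP; split=> [_ [n _ <-]|_ [n _ <-]]; exists n.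
have su : has_sup (range u) by split=> //; exists (u 0%N); exists 0%N.
apply/eqP; rewrite eq_le; apply/andP; split; last first.
  by apply: ge_sup; [exact: su.1|move=> _ [n _ <-]; exact: hamiltonian_ge].
apply: hamiltonian_le => a; apply/ler_addgt0Pr => e e0.
pose k b := dotrv b p - L x b.
have ck : continuous k.
  move=> b; apply: differentiable_continuous.
  apply: (@differentiableB _ _ _ (fun b => dotrv b p) (L x) b); last first.
    exact: differentiable_lagrangian.
  rewrite (_ : (fun b => dotrv b p) = \sum_(i < d) (fun b : 'rV[R]_d => b 0 i * p 0 i)).
    apply: differentiable_sum => i.
    by apply: differentiableM => //; exact: differentiable_coord.
  by apply/funext => c; rewrite fct_sumE.
have oU : open (k @^-1` [set y | k a - e < y]).
  by apply: open_comp => //; exact: open_gt.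
have Ua : (k @^-1` [set y | k a - e < y]) a by rewrite /= ltrBlDr ltrDl.
move: Ua; rewrite {1}(open_rV_bigcup oU) => -[[q n] /= qU _].
have := qU _ (ballxx _ _); rewrite invr_gt0 ltr0n => /(_ isT) /=.
rewrite ltrBlDr => /ltW kq; rewrite (le_trans kq)// lerD2r.
apply: sup_upper_bound => //; exists (pickle q) => //.
by rewrite /u /rat_vec pickleK.
Qed.

Lemma measurable_hamiltonian (p : 'rV[R]_d -> 'rV[R]_d) : measurable_fun setT p ->
  measurable_fun setT (fun x => hamiltonian L x (p x)).
Proof.
move=> mp.
rewrite (_ : (fun x => _) =
    (fun x => sups (fun n => dotrv (rat_vec n) (p x) - L x (rat_vec n)) 0)); last first.
  by apply/funext => x; exact: hamiltonian_sups.
apply: (@measurable_fun_sups _ _ _ _ (fun n x => dotrv (rat_vec n) (p x) - L x (rat_vec n))).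
  move=> x _; have [M HM] := legendre_bounded x (p x).
  by exists M => _ [n _ <-].
move=> n; apply: measurable_funB; last first.
  by apply: continuous_measurable_rV; exact: continuous_lagrangian1.
apply: measurable_sum => i; apply: measurable_funM => //.
exact: (measurableT_comp (@measurable_coord R d i) mp).
Qed.

Lemma measurable_grad_hamiltonian (p : 'rV[R]_d -> 'rV[R]_d) : measurable_fun setT p ->
  measurable_fun setT (fun x => grad (hamiltonian L x) (p x)).
Proof.
move=> mp; apply: measurable_fun_rV => i.
rewrite (_ : (fun x => _) = (fun x => lim ((fun h : R => h^-1 *
    (hamiltonian L x (p x + h *: delta_mx 0 i) - hamiltonian L x (p x))) @ 0^'))); last first.
  by apply/funext => x; rewrite mxE /partial derive_quotientE.
have H := (@measurable_lim_at0 R _ _ (fun (x : 'rV[R]_d) h => h^-1 *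
    (hamiltonian L x (p x + h *: delta_mx 0 i) - hamiltonian L x (p x)))).
apply: H => [h h0|x h h0].
  apply: measurable_funM => //; apply: measurable_funB; last exact: measurable_hamiltonian.
  apply: (measurable_hamiltonian (p := fun x => p x + h *: delta_mx 0 i)).
  apply: measurable_fun_rV => j.
  rewrite (_ : (fun x => _) = (fun x => p x 0 j + (h *: delta_mx 0 i : 'rV[R]_d) 0 j)).
    apply: measurable_funD => //; exact: (measurableT_comp (@measurable_coord R d j) mp).
  by apply/funext => x; rewrite mxE.
apply: continuousM; first exact: inv_continuous.
by apply: continuousB; [exact: hamiltonian_line_continuous|exact: cst_continuous].
Qed.

End hamiltonian.

(** * Measurability of the flow, and the Lipschitz estimate *)

Section flow_measurability.
Context (R : realType) (d : nat) (T : R).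
Context (L : 'rV[R]_d -> 'rV[R]_d -> R) (F G : 'rV[R]_d -> P1 R d -> R).
Context (Cb dx eps : R) (rho : 'rV[R]_d -> R) (N : nat) (mu : R -> P1 R d).
Hypotheses (dx0 : 0 < dx) (eps0 : 0 < eps) (Cb0 : 0 < Cb) (T0 : 0 < T) (N0 : (0 < N)%N).
Hypotheses (hL : lagrangian L) (hF : coupling_cost F) (hG : coupling_cost G).
Hypothesis hrho : mollifier rho.

Lemma value_mollified_continuous t :
  continuous (value_mollified T L F G Cb rho N dx eps mu t).
Proof.
have [_ [rho0 _ _ irho _]] := hrho.
have [B vB] := value_back_bounded mu dx0 Cb0 T0 N0 hL hF hG
  (N - Num.truncn (t / dt T N)).
have B0 : 0 <= B by rewrite (le_trans _ (vB 0)).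
apply: (@convolution_continuous _ _ _ _ (#|{: {ffun 'I_d -> 'I_4}}|%:R * B)
  (#|{: {ffun 'I_d -> 'I_4}}|%:R * (B * (d%:R / dx))) dx) => //.
- by rewrite !mulr_ge0// invr_ge0 ltW.
- exact: (integrable_rescaled eps0 (irho [::])).
- by move=> y; rewrite /rho_eps mulr_ge0// invr_ge0 exprn_ge0// ltW.
- by move=> x; exact: interp1_bounded.
- by move=> x y; exact: interp1_lipschitz.
Qed.

(** The drift is the gradient of the Hamiltonian at the gradient of the mollified
    value function, and both gradients are Borel. *)
Lemma measurable_flow k : measurable_fun setT (flow T L F G Cb rho N dx eps mu k).
Proof.
have mD : measurable_fun setT (drift T L F G Cb rho N dx eps mu (tk T N k)).
  apply: (measurable_grad_hamiltonian hL).
  exact: (measurable_grad (value_mollified_continuous (t := _))).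
apply: measurable_fun_rV => i.
rewrite (_ : (fun x => _) = (fun x : 'rV[R]_d => x 0 i - dt T N *
    drift T L F G Cb rho N dx eps mu (tk T N k) x 0 i)); last first.
  by apply/funext => x; rewrite !mxE.
apply: measurable_funB; first exact: measurable_coord.
apply: measurable_funM => //.
exact: (measurableT_comp (@measurable_coord R d i) mD).
Qed.

End flow_measurability.

Unset Implicit Arguments.
Set Strict Implicit.
Set Printing Implicit Defensive.

Theorem proposition4p4 (R : realType) (d : nat) (T : R)
    (L : 'rV[R]_d -> 'rV[R]_d -> R) (F G : 'rV[R]_d -> P1 R d -> R)
    (m0s : P1 R d) (m0 : 'rV[R]_d -> R) (p : \bar R) (Cstar : R)
    (rho : 'rV[R]_d -> R) (Cb Cbf : R)
    (hd : (1 <= d)%N) (hT : 0 < T)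
    (hL : lagrangian L) (hF : coupling_cost F) (hG : coupling_cost G)
    (hp : (1 < p)%E) (hCstar : 0 < Cstar) (hm0 : initial_datum m0s m0 p Cstar)
    (hrho : mollifier rho)
    (hCb0 : 0 < Cb) (hCb : optimal_control_bound T L F G Cb)
    (hCbf0 : 0 < Cbf) (hCbf : drift_bound T L F G Cb rho Cbf)
    (mu : R -> P1 R d) (hmu : continuous_curve T mu)
    (N : nat) (dx eps : R) (hN : (1 <= N)%N) (hdx : 0 < dx) (heps : 0 < eps) :
  exists m : R -> P1 R d,
    (forall t : R, 0 <= t <= T -> forall A : set 'rV[R]_d, measurable A ->
       m t A = (\int[lebesgue_rV R d]_(x in A)
                  (density T L F G Cb rho m0 N dx eps mu t x)%:E)%E) /\
    forall c : R, 0 < c -> dx <= c * dt T N ->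
    forall t s : R, 0 <= t <= T -> 0 <= s <= T ->
      (d1 (m t) (m s) <= ((Cbf + c * Num.sqrt d%:R) * `|t - s|)%:E)%E.
Proof.
have [_ _ m0E _ _] := hm0.
have [m [mE md1]] := density_laws hdx hN hT m0E
  (fun k _ => measurable_flow mu hdx heps hCb0 hT hN hL hF hG hrho k)
  (fun t x => hCbf mu N dx eps hmu hN hdx heps t x).
by exists m; split=> // c _; exact: md1.
Qed.
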